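(* Let $d\ge 1$ and assume $1<p<\infty$ and $0<s\le1$. Then for any $M>0$, there exist $f,g\in\mathcal S(\mathbb R^d)$ such that $$\|J^sf\|_p+\|g\|_{\mathrm{BMO}}\le1,$$ but $$\|D^s(fg)-fD^sg\|_p>M.$$
   Context: $\mathcal S(\mathbb R^d)$ is the space of Schwartz functions, $\|\cdot\|_p$ the $L^p(\mathbb R^d)$ norm. $J^s=(1-\Delta)^{s/2}$ and $D^s=(-\Delta)^{s/2}$ are the Fourier multipliers with symbols $(1+|\xi|^2)^{s/2}$ and $|\xi|^s$. The BMO norm is $\|u\|_{\mathrm{BMO}}=\sup_Q\frac1{|Q|}\int_Q|u-u_Q|\,dy$ ($u_Q$ the average over $Q$, supremum over all cubes $Q\subset\mathbb R^d$). *)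

(* Defs.v *)
From HB Require Import structures.
From mathcomp Require Import all_boot all_order all_algebra complex.
From mathcomp Require Import all_classical all_reals all_analysis.

Set Implicit Arguments.
Unset Strict Implicit.
Unset Printing Implicit Defensive.
Import Order.TTheory GRing.Theory Num.Theory.
Import numFieldNormedType.Exports.

Local Open Scope classical_set_scope.
Local Open Scope ring_scope.

(* The Borel sigma-algebra of R^n, generated by the coordinate maps. *)
Section measurable_rV.
Context {R : realType} (n : nat).

Let coord (i : 'I_n) (v : 'rV[R]_n) : R := v ord0 i.

Let rV_set0 : g_sigma_preimage coord set0.
Proof. exact: sigma_algebra0. Qed.

Let rV_setC A : g_sigma_preimage coord A -> g_sigma_preimage coord (~` A).
Proof. exact: sigma_algebraC. Qed.

Let rV_bigcup (F : (set 'rV[R]_n)^nat) :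
  (forall i, g_sigma_preimage coord (F i)) ->
  g_sigma_preimage coord (\bigcup_i (F i)).
Proof. exact: sigma_algebra_bigcup. Qed.

HB.instance Definition _ := @isMeasurable.Build default_measure_display
  'rV[R]_n (g_sigma_preimage coord) rV_set0 rV_setC rV_bigcup.

Lemma measurable_coord (i : 'I_n) :
  measurable_fun [set: 'rV[R]_n] (fun v => v ord0 i).
Proof.
move=> _ Y mY; rewrite setTI; apply: sub_sigma_algebra => /=.
rewrite -bigcup_seq/=; exists i => /=; first by rewrite mem_index_enum.
by exists Y => //; rewrite setTI.
Qed.

Lemma measurable_fun_coordP d (T : measurableType d) (f : T -> 'rV[R]_n) :
  (forall i, measurable_fun [set: T] (fun x => f x ord0 i)) ->
  measurable_fun [set: T] f.
Proof.
move=> mf _ A mA; rewrite setTI.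
suff : g_sigma_preimage coord `<=` [set B | measurable (f @^-1` B)] by apply.
apply: smallest_sub => [|B].
  split => /=; first by rewrite preimage_set0.
    by move=> B mB; rewrite setTD preimage_setC; exact: measurableC.
  by move=> F mF; rewrite preimage_bigcup; exact: bigcupT_measurable.
rewrite -bigcup_seq => -[i _ [C mC <-]] /=.
by rewrite setTI -comp_preimage -[X in measurable X]setTI; exact: mf.
Qed.

End measurable_rV.

Section lebesgue_rV.
Context {R : realType}.

Definition cons_rV n (x : R * 'rV[R]_n) : 'rV[R]_n.+1 :=
  row_mx (x.1)%:M x.2 : 'rV_(1 + n).

Definition uncons_rV n (v : 'rV[R]_n.+1) : R * 'rV[R]_n :=
  (v ord0 ord0, \row_j v ord0 (lift ord0 j)).

Lemma cons_rV0 n (x : R * 'rV[R]_n) : cons_rV x ord0 ord0 = x.1.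
Proof. by rewrite mxE; case: splitP => // j _; rewrite mxE !ord1 mulr1n. Qed.

Lemma cons_rVS n (x : R * 'rV[R]_n) (i : 'I_n) :
  cons_rV x ord0 (lift ord0 i) = x.2 ord0 i.
Proof.
rewrite mxE; case: splitP => j /=; first by rewrite ord1.
by rewrite /bump/= !add1n => -[] /val_inj ->.
Qed.

Lemma cons_rVK n : cancel (@cons_rV n) (@uncons_rV n).
Proof.
move=> [a u]; rewrite /uncons_rV cons_rV0; congr pair.
by apply/rowP => i; rewrite mxE cons_rVS.
Qed.

Lemma measurable_cons_rV n :
  measurable_fun [set: measurableTypeR R * 'rV[R]_n] (@cons_rV n).
Proof.
apply: measurable_fun_coordP => i.
case: (unliftP ord0 i) => [j|] ->.
  under eq_fun do rewrite cons_rVS.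
  exact: (measurableT_comp (measurable_coord j) measurable_snd).
under eq_fun do rewrite cons_rV0.
exact: measurable_fst.
Qed.

Lemma measurable_uncons_rV n :
  @measurable_fun _ _ 'rV[R]_n.+1 (measurableTypeR R * 'rV[R]_n)%type
    setT (@uncons_rV n).
Proof.
apply: measurable_fun_pair => /=; first exact: measurable_coord.
apply: measurable_fun_coordP => i.
under eq_fun do rewrite mxE.
exact: measurable_coord.
Qed.

Section step.
Context n (mu : {sigma_finite_measure set 'rV[R]_n -> \bar R}).

(* The image of the product measure under R * R^n ~ R^n.+1. *)
Definition lebesgue_rV_step : set 'rV[R]_n.+1 -> \bar R :=
  pushforward (@lebesgue_measure R \x mu)%E (@cons_rV n).

Let mcons (A : set 'rV[R]_n.+1) : measurable A ->
  (@measurable _ (measurableTypeR R * 'rV[R]_n)%type) (@cons_rV n @^-1` A).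
Proof.
by move=> mA; rewrite -[X in measurable X]setTI; exact: measurable_cons_rV.
Qed.

Let step0 : lebesgue_rV_step set0 = 0%E.
Proof. by rewrite /lebesgue_rV_step /pushforward preimage_set0 measure0. Qed.

Let step_ge0 A : (0 <= lebesgue_rV_step A)%E.
Proof. by rewrite /lebesgue_rV_step /pushforward; exact: measure_ge0. Qed.

Let step_sigma_additive : semi_sigma_additive lebesgue_rV_step.
Proof.
move=> F mF tF mUF; rewrite /lebesgue_rV_step /pushforward preimage_bigcup.
apply: measure_semi_sigma_additive => [k||]; first exact: mcons.
  apply/trivIsetP => /= i j _ _ ij; rewrite -preimage_setI.
  by move/trivIsetP : tF => /(_ _ _ _ _ ij) ->//; rewrite preimage_set0.
by rewrite -preimage_bigcup; exact: mcons.
Qed.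

HB.instance Definition _ := isMeasure.Build _ _ _ lebesgue_rV_step
  step0 step_ge0 step_sigma_additive.

Let step_sigma_finite : sigma_finite setT lebesgue_rV_step.
Proof.
have /sigma_finiteP[F [TF ndF Foo]] := sigma_finiteT (@lebesgue_measure R).
have /sigma_finiteP[G [TG ndG Goo]] := sigma_finiteT mu.
exists (fun k => @uncons_rV n @^-1` (F k `*` G k)).
  apply/esym/seteqP; split => // v _; rewrite -preimage_bigcup/=.
  have [k _ Fk] : (\bigcup_i F i) (uncons_rV v).1 by rewrite -TF.
  have [l _ Gl] : (\bigcup_i G i) (uncons_rV v).2 by rewrite -TG.
  exists (maxn k l) => //; split.
    by move: Fk; exact/subsetPset/ndF/leq_maxl.
  by move: Gl; exact/subsetPset/ndG/leq_maxr.
move=> k; have [mF Fk] := Foo k; have [mG Gk] := Goo k; split.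
  rewrite -[X in measurable X]setTI; apply: measurable_uncons_rV => //.
  exact: measurableX.
rewrite /lebesgue_rV_step /pushforward -comp_preimage.
rewrite (_ : _ \o _ = id) ?preimage_id; last exact/funext/cons_rVK.
by rewrite product_measure1E// lte_mul_pinfty// ge0_fin_numE.
Qed.

HB.instance Definition _ := Measure_isSigmaFinite.Build _ _ _ lebesgue_rV_step
  step_sigma_finite.

End step.

Fixpoint lebesgue_rV n : {sigma_finite_measure set 'rV[R]_n -> \bar R} :=
  if n is m.+1 then lebesgue_rV_step (lebesgue_rV m) else \d_(0 : 'rV[R]_0).

Lemma lebesgue_rV_box n (A : 'I_n -> set R) : (forall i, measurable (A i)) ->
  lebesgue_rV n [set v | forall i, A i (v ord0 i)] =
  (\prod_(i < n) lebesgue_measure (A i))%E.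
Proof.
elim: n A => [|n IH] A mA.
  rewrite big_ord0 /= diracE mem_set//= => -[]//.
have mB : measurable [set v : 'rV[R]_n | forall i, A (lift ord0 i) (v ord0 i)].
  rewrite (_ : [set _ | _] = \big[setI/setT]_(i < n)
      ((fun v : 'rV[R]_n => v ord0 i) @^-1` A (lift ord0 i))).
    apply: bigsetI_measurable => i _.
    by rewrite -[X in measurable X]setTI; exact: measurable_coord.
  apply/seteqP; split => [v /= Av|v].
    by rewrite -bigcap_seq => i _ /=; exact: Av.
  by rewrite -bigcap_seq => Av i; apply: (Av i); rewrite /= mem_index_enum.
rewrite big_ord_recl -IH// -product_measure1E//.
  congr ((_ \x _)%E _); apply/seteqP; split => -[a u] /=.
    move=> Aau; split; first by have := Aau ord0; rewrite cons_rV0.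
    by move=> i; have := Aau (lift ord0 i); rewrite cons_rVS.
  move=> [/= Aa Au] i; case: (unliftP ord0 i) => [j|] ->.
    by rewrite cons_rVS; exact: Au.
  by rewrite cons_rV0.
exact: (mA ord0).
Qed.

End lebesgue_rV.
Arguments lebesgue_rV R n : clear implicits.

Section harmonic_analysis.
Context {R : realType} {d : nat}.
Local Open Scope complex_scope.

Local Notation leb := (lebesgue_rV R d).
Local Notation Re := (@complex.Re R).
Local Notation Im := (@complex.Im R).
Local Notation normc := (@Normc.normc R).
Implicit Types (x y xi : 'rV[R]_d) (f u : 'rV[R]_d -> R[i]).

(* The norm `|x| of the library on 'rV[R]_d is the sup norm. *)
Definition dotp x y : R := \sum_(i < d) x ord0 i * y ord0 i.
Definition enorm x : R := Num.sqrt (dotp x x).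

Definition Cintegral (A : set 'rV[R]_d) f : R[i] :=
  (\int[leb]_(x in A) Re (f x)) +i* (\int[leb]_(x in A) Im (f x)).

Definition cis (t : R) : R[i] := cos t +i* sin t.

(* With this normalization -Delta has symbol |xi|^2. *)
Definition fourier f xi : R[i] :=
  Cintegral setT (fun x => f x * cis (- dotp x xi)).

Definition inverse_fourier f x : R[i] :=
  (((2 * pi) ^+ d)^-1)%:C * Cintegral setT (fun xi => f xi * cis (dotp x xi)).

Definition fourier_multiplier (m : 'rV[R]_d -> R) f : 'rV[R]_d -> R[i] :=
  inverse_fourier (fun xi => (m xi)%:C * fourier f xi).

Definition bessel_potential (s : R) :=
  fourier_multiplier (fun xi => (1 + enorm xi ^+ 2) `^ (s / 2)).

Definition fractional_laplacian (s : R) :=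
  fourier_multiplier (fun xi => enorm xi `^ s).

Definition Lp_norm (p : R) f : \bar R :=
  Lnorm leb p%:E (fun x => (normc (f x))%:E).

(* The cube with lower corner a and side length l, sides parallel to the axes. *)
Definition cube (a : 'rV[R]_d) (l : R) : set 'rV[R]_d :=
  [set x | forall i, a ord0 i <= x ord0 i <= a ord0 i + l].

Definition average f (Q : set 'rV[R]_d) : R[i] :=
  ((fine (leb Q))^-1)%:C * Cintegral Q f.

Definition mean_oscillation f (Q : set 'rV[R]_d) : \bar R :=
  (((fine (leb Q))^-1)%:E *
   \int[leb]_(y in Q) (normc (f y - average f Q))%:E)%E.

Definition BMO_norm f : \bar R :=
  ereal_sup [set o | exists (a : 'rV[R]_d) (l : R),
    0 < l /\ o = mean_oscillation f (cube a l)].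

Definition partial (i : 'I_d) (h : 'rV[R]_d -> R) : 'rV[R]_d -> R :=
  'D_(delta_mx ord0 i) h.

(* The multi-index derivative in which i has multiplicity count_mem i b. For
   smooth functions the order of b is irrelevant. *)
Definition partials (b : seq 'I_d) (h : 'rV[R]_d -> R) : 'rV[R]_d -> R :=
  foldr partial h b.

Definition smooth (h : 'rV[R]_d -> R) : Prop :=
  forall b x, differentiable (partials b h) x.

Definition Cpartials (b : seq 'I_d) f x : R[i] :=
  partials b (Re \o f) x +i* partials b (Im \o f) x.

Definition schwartz f : Prop :=
  [/\ smooth (Re \o f), smooth (Im \o f) &
      forall (a : 'I_d -> nat) (b : seq 'I_d), exists K : R, forall x,
        `|\prod_(i < d) x ord0 i ^+ a i| * normc (Cpartials b f x) <= K].

End harmonic_analysis.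

(* Main.v *)
Require Import Defs.
From mathcomp Require Import all_boot all_order all_algebra complex.
From mathcomp Require Import all_classical all_reals all_analysis.
From mathcomp Require Import measurable_realfun ring lra.
Set Implicit Arguments.
Unset Strict Implicit.
Unset Printing Implicit Defensive.
Import Order.TTheory GRing.Theory Num.Theory.
Import numFieldNormedType.Exports.
Local Open Scope classical_set_scope.
Local Open Scope ring_scope.

(** The norm of g in BMO does not see constants, but the commutator does:
replacing g by g + c adds c D^s f to D^s(fg) - f D^s g. So the inequality fails
for a function g that is nearly a large constant on a large region while its BMO
norm stays small, like a truncated logarithm.

All functions are taken to be sums of Gaussians (gsum), for which products,
Fourier transforms and multipliers can be computed: f = e exp(-|x|^2) and
g = c sum_(k < N) exp(-(t/2^k)^2 |x|^2), with small e, c and t that do not depend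
on N, and N large. Up to the scale 1/t the function g is close to c N, and it
decreases to 0 only logarithmically over the scales 2^k / t, k < N.

- BMO. On a cube of side l a Gaussian of width 1/r oscillates by at most a
  constant times min(r l, 1/(r l)) (oscr_gaussn). Over dyadic r these bounds have
  a bounded sum (dyadic_sum_le), so the BMO norm of g is at most a constant times
  c, uniformly in N (BMO_norm_gsum).

- Commutator. The function f g is a sum of Gaussians with exponents in [1, 2], and
  D^s of such a Gaussian is at least some c0 > 0 on a fixed cube at the origin
  (frac_gauss_lower). On the other hand D^s exp(-a|x|^2) is O(a^(s/2)) by scaling
  (frac_gauss_small), so that for small t the term f D^s g takes away at most half
  of it. On the cube the commutator is at least a constant times e c N
  (commutator_lower), and so is its L^p norm (Lp_norm_ge).

- Bessel potential. What remains is that J^s exp(-|x|^2) has a finite L^p norm, in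
  other words a decay estimate for the inverse Fourier transform of a function
  that is not a Gaussian. By subordination w^(s/2) is a multiple of the integral of
  (1 - exp(-t w)) t^(-1-s/2) over t > 0 (integral_subord); applied to the symbol
  1 + |xi|^2 this expresses the potential through differences between
  exp(-|x|^2) and a damped, spread out Gaussian. Such a difference is at most a
  constant times min(1, t) times the product of the 1 / (1 + x_i^2) (heat_diff).
  The product is integrable and bounded, hence in every L^p
  (Lp_norm_le_cauchyn). *)

(** * Real-valued Lebesgue integrals *)

Section integrable_real.
Context d (T : measurableType d) (R : realType).
Variable mu : {measure set T -> \bar R}.
Variables (D : set T) (mD : measurable D).
Implicit Types f g : T -> R.

Lemma integrableZR (k : R) f : mu.-integrable D (EFin \o f) ->
  mu.-integrable D (EFin \o (fun x => k * f x)).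
Proof. by move=> fi; have := integrableZl mD k fi; apply: eq_integrable. Qed.

Lemma integrableDR f g : mu.-integrable D (EFin \o f) ->
  mu.-integrable D (EFin \o g) ->
  mu.-integrable D (EFin \o (fun x => f x + g x)).
Proof. by move=> fi gi; have := integrableD mD fi gi; apply: eq_integrable. Qed.

Lemma integrableBR f g : mu.-integrable D (EFin \o f) ->
  mu.-integrable D (EFin \o g) ->
  mu.-integrable D (EFin \o (fun x => f x - g x)).
Proof. by move=> fi gi; have := integrableB mD fi gi; apply: eq_integrable. Qed.

Lemma integrable_normr f : mu.-integrable D (EFin \o f) ->
  mu.-integrable D (EFin \o (fun x => `|f x|)).
Proof. by move=> fi; have := integrable_norm fi; apply: eq_integrable. Qed.

Lemma le_integrableR f g : measurable_fun D f ->
  (forall x, D x -> `|f x| <= g x) -> mu.-integrable D (EFin \o g) ->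
  mu.-integrable D (EFin \o f).
Proof.
move=> mf fg gi; apply: (le_integrable mD _ _ gi); first exact/measurable_EFinP.
by move=> x Dx; rewrite lee_fin (le_trans (fg x Dx))// ler_norm.
Qed.

Lemma integrable_cstR (r : R) : (mu D < +oo)%E ->
  mu.-integrable D (EFin \o (fun=> r)).
Proof.
move=> Doo; apply: measurable_bounded_integrable => //; exists `|r|; split=> //.
by move=> M rM x _ /=; exact: ltW.
Qed.

Lemma integrable_sumR (I : Type) (s : seq I) (F : I -> T -> R) :
  (forall i, mu.-integrable D (EFin \o F i)) ->
  mu.-integrable D (EFin \o (fun x => \sum_(i <- s) F i x)) /\
  \int[mu]_(x in D) (\sum_(i <- s) F i x) =
    \sum_(i <- s) \int[mu]_(x in D) F i x.
Proof.
move=> Fi; elim: s => [|i s [ih1 ih2]].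
  split.
    have := @integrable0 _ _ _ mu D.
    by apply: eq_integrable => // x _ /=; rewrite big_nil.
  under eq_Rintegral do rewrite big_nil.
  by rewrite big_nil /Rintegral integral0.
split.
  have := integrableDR (Fi i) ih1.
  by apply: eq_integrable => // x _ /=; rewrite big_cons.
under eq_Rintegral do rewrite big_cons.
by rewrite RintegralD// big_cons ih2.
Qed.

End integrable_real.

Section integral_subset.
Context d (T : measurableType d) (R : realType).
Variable mu : {measure set T -> \bar R}.

(** The integral of a nonnegative function is a supremum over the simple
functions below it, so it is monotone even for functions whose measurability
has not been established, such as multiplier operators applied to Gaussians. *)
Lemma ge0_le_integralT (f h : T -> \bar R) :
  (forall x, 0 <= f x)%E -> (forall x, f x <= h x)%E ->
  (\int[mu]_x f x <= \int[mu]_x h x)%E.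
Proof.
move=> f0 fh; have h0 x : (0 <= h x)%E by exact: le_trans (fh x).
rewrite !ge0_integralTE//; apply: ge_ereal_sup => _ [k kf <-].
by apply: ereal_sup_ubound; exists k => // x; exact: le_trans (fh x).
Qed.

Lemma le_Rintegral_subset (Q : set T) (f g : T -> R) : measurable Q ->
  mu.-integrable setT (EFin \o f) -> mu.-integrable setT (EFin \o g) ->
  (forall x, Q x -> f x <= g x) -> (forall x, 0 <= g x) ->
  \int[mu]_(x in Q) f x <= \int[mu]_x g x.
Proof.
move=> mQ fi gi fg g0; rewrite Rintegral_mkcond; apply: le_Rintegral => //.
  rewrite -restrict_EFin; apply/integrable_restrict => //; rewrite setTI.
  exact: (integrableS measurableT).
by move=> x _; rewrite patchE; case: ifPn => // /set_mem; exact: fg.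
Qed.

End integral_subset.

Section fubini_real.
Context d1 d2 (T1 : measurableType d1) (T2 : measurableType d2) (R : realType).
Variables (m1 : {sigma_finite_measure set T1 -> \bar R}).
Variables (m2 : {sigma_finite_measure set T2 -> \bar R}).

Section prod.
Variables (u : T1 -> R) (v : T2 -> R).
Hypotheses (ui : m1.-integrable setT (EFin \o u)).
Hypotheses (vi : m2.-integrable setT (EFin \o v)).

Lemma integrable_prod :
  (m1 \x m2)%E.-integrable setT (EFin \o (fun z => u z.1 * v z.2)).
Proof.
have /integrableP[mu_ iu] := ui; have /integrableP[mv iv] := vi.
have mw : measurable_fun setT (EFin \o (fun z : T1 * T2 => u z.1 * v z.2)).
  apply/measurable_EFinP; apply: measurable_funM.
    by apply: measurableT_comp; [exact/measurable_EFinP|exact: measurable_fst].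
  by apply: measurableT_comp; [exact/measurable_EFinP|exact: measurable_snd].
apply/(integrable12ltyP _ _ mw).
have mav : measurable_fun setT (fun x => `|v x|%:E).
  by apply/measurable_EFinP/measurableT_comp => //; exact/measurable_EFinP.
have mau : measurable_fun setT (fun x => `|u x|%:E).
  by apply/measurable_EFinP/measurableT_comp => //; exact/measurable_EFinP.
under eq_integral => a _ do under eq_integral => w _ do
  rewrite /= normrM EFinM.
under eq_integral => a _ do rewrite ge0_integralZl_EFin//.
rewrite ge0_integralZr//; last exact: integral_ge0.
by rewrite lte_mul_pinfty// ?integral_ge0// ge0_fin_numE// integral_ge0.
Qed.

Lemma Rintegral_prod : \int[(m1 \x m2)%E]_z (u z.1 * v z.2) =
  (\int[m1]_x u x) * \int[m2]_x v x.
Proof.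
rewrite {1}/Rintegral -(integral12_prod_meas1 integrable_prod) /fubini_F.
under eq_integral => a _ do under eq_integral => w _ do rewrite /= EFinM.
under eq_integral => a _ do rewrite integralZl//.
rewrite /Rintegral -fineM ?integrable_fin_num//; congr fine.
have /fineK <- : (\int[m2]_x (v x)%:E)%E \is a fin_num.
  by rewrite integrable_fin_num.
by rewrite integralZr.
Qed.

End prod.

Lemma Rintegral_swap (f : T1 * T2 -> R) :
  (m1 \x m2)%E.-integrable setT (EFin \o f) ->
  (forall x, m2.-integrable setT (EFin \o (fun y => f (x, y)))) ->
  (forall y, m1.-integrable setT (EFin \o (fun x => f (x, y)))) ->
  \int[m1]_x \int[m2]_y f (x, y) = \int[m2]_y \int[m1]_x f (x, y).
Proof.
move=> fi f1 f2; rewrite /Rintegral.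
under eq_integral => x _ do rewrite fineK ?(integrable_fin_num _ (f1 x))//.
under [in RHS]eq_integral => y _ do
  rewrite fineK ?(integrable_fin_num _ (f2 y))//.
by congr fine; exact: (Fubini fi).
Qed.

End fubini_real.

Section tensor.
Context {R : realType}.
Local Notation mu := (@lebesgue_measure R).

Definition rV_tail n (x : 'rV[R]_n.+1) : 'rV[R]_n :=
  \row_j x ord0 (lift ord0 j).

Lemma cons_rV_tail n (a : R) (v : 'rV[R]_n) : rV_tail (cons_rV (a, v)) = v.
Proof. by apply/rowP => j; rewrite mxE cons_rVS. Qed.

Lemma measurable_rV_tail n : measurable_fun [set: 'rV[R]_n.+1] (@rV_tail n).
Proof.
exact: measurableT_comp measurable_snd (@measurable_uncons_rV R n).
Qed.

(** Lebesgue measure on R^(n+1) is the image of a product measure, so a function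
that splits into the first coordinate and the others integrates to a product.
The integrals over R^n computed below are reduced to dimension one by iterating
this. *)
Lemma integrable_tensor n (u : R -> R) (v : 'rV[R]_n -> R) :
  mu.-integrable setT (EFin \o u) ->
  (lebesgue_rV R n).-integrable setT (EFin \o v) ->
  (lebesgue_rV R n.+1).-integrable setT
    (EFin \o (fun x : 'rV[R]_n.+1 => u (x ord0 ord0) * v (rV_tail x))) /\
  \int[lebesgue_rV R n.+1]_x (u (x ord0 ord0) * v (rV_tail x)) =
    (\int[mu]_x u x) * \int[lebesgue_rV R n]_x v x.
Proof.
move=> iu iv.
pose W := EFin \o (fun x : 'rV[R]_n.+1 => u (x ord0 ord0) * v (rV_tail x)).
have mW : measurable_fun setT W.
  have /measurable_int/measurable_EFinP mu_ := iu.
  have /measurable_int/measurable_EFinP mv := iv.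
  apply/measurable_EFinP; apply: measurable_funM.
    exact: measurableT_comp mu_ (@measurable_coord R n.+1 ord0).
  exact: measurableT_comp mv (@measurable_rV_tail n).
have WE z : (W \o @cons_rV R n) z = (u z.1 * v z.2)%:E.
  by case: z => a w; rewrite /W /= cons_rV0 cons_rV_tail.
have iW : (mu \x lebesgue_rV R n)%E.-integrable setT (W \o @cons_rV R n).
  by apply: eq_integrable (integrable_prod iu iv) => // z _; rewrite WE.
have mc := @measurable_cons_rV R n.
split.
  by apply: (@integrable_pushforward _ _ _ _ _ _ mc _ setT W).
rewrite -(Rintegral_prod iu iv).
transitivity (fine (\int[lebesgue_rV R n.+1]_x W x)%E); first by [].
rewrite (integral_pushforward mc)// preimage_setT; congr fine.
by apply: eq_integral => z _; rewrite WE.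
Qed.

End tensor.

Section scaling.
Context {R : realType}.
Local Notation mu := (@lebesgue_measure R).

(** Both sides are integrals against measures that agree on intervals. *)
Lemma ge0_integral_scale (c : R) (f : R -> \bar R) : 0 < c ->
  measurable_fun setT f -> (forall x, 0 <= f x)%E ->
  (\int[mu]_x f (c * x)%R = (c^-1)%:E * \int[mu]_x f x)%E.
Proof.
move=> c0 mf f0.
pose phi (x : measurableTypeR R) : measurableTypeR R := c * x.
have mphi : measurable_fun [set: measurableTypeR R] phi.
  exact: mulrl_measurable.
have := @ge0_integral_pushforward _ _ _ _ _ _ mphi mu setT f measurableT mf
  (fun x _ => f0 x).
rewrite preimage_setT => <-.
have ci0 : 0 <= c^-1 by rewrite invr_ge0 ltW.
rewrite -(@ge0_integral_mscale _ _ _ mu _ measurableT (NngNum ci0))//=.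
apply: eq_measure_integral => B mB _.
pose nu : {measure set (measurableTypeR R) -> \bar R} :=
  measure_function_pushforward__canonical__measure_function_Measure mu mphi.
have Hc : mu B = mscale (NngNum (ltW c0)) nu B.
  apply: (lebesgue_measure_unique (mu := mscale (NngNum (ltW c0)) nu)) mB.
  move=> _ [[a b]] _ <-.
  transitivity (c%:E * mu (phi @^-1` `]a, b]))%E; last by [].
  have -> : phi @^-1` `]a, b]%classic = `]c^-1 * a, c^-1 * b]%classic.
    by apply/seteqP; split => x /=; rewrite !in_itv/= ltr_pdivrMl// ler_pdivlMl.
  rewrite !lebesgue_measure_itv/= !lte_fin ltr_pM2l ?invr_gt0//.
  case: ifPn => _; last by rewrite mule0.
  rewrite -!EFinB -EFinM; congr EFin; field.
  by rewrite gt_eqF.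
transitivity ((c^-1)%:E * mu B)%E; last by [].
rewrite Hc; transitivity ((c^-1)%:E * (c%:E * nu B))%E; last by [].
by rewrite muleA -EFinM mulVf ?gt_eqF// mul1e.
Qed.

Lemma integrable_scale (c : R) (f : R -> R) : 0 < c ->
  mu.-integrable setT (EFin \o f) ->
  mu.-integrable setT (EFin \o (fun x => f (c * x))) /\
  \int[mu]_x f (c * x) = c^-1 * \int[mu]_x f x.
Proof.
move=> c0 fi; have /integrableP[mf fioo] := fi.
have mc : measurable_fun setT (fun x : R => c * x) by exact: mulrl_measurable.
have mfc : measurable_fun setT (EFin \o (fun x => f (c * x))).
  by apply/measurable_EFinP; apply: measurableT_comp mc; exact/measurable_EFinP.
split.
  apply/integrableP; split=> //.
  rewrite (ge0_integral_scale (f := fun x => `|(f x)%:E|)%E c0)//.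
    by rewrite lte_mul_pinfty// lee_fin invr_ge0 ltW.
  exact: measurableT_comp mf.
rewrite /Rintegral integralE [in RHS]integralE.
have En := ge0_integral_scale c0 (measurable_funeneg mf) (funeneg_ge0 _).
have Ep := ge0_integral_scale c0 (measurable_funepos mf) (funepos_ge0 _).
transitivity (fine ((c^-1)%:E * (\int[mu]_x (EFin \o f)^\+ x) -
    (c^-1)%:E * (\int[mu]_x (EFin \o f)^\- x))%E).
  rewrite -En -Ep; congr (fine (_ - _)); apply: eq_integral => x _.
    by rewrite !funeposE.
  by rewrite !funenegE.
have PE := fineK (integrable_pos_fin_num measurableT fi).
have NE := fineK (integrable_neg_fin_num measurableT fi).
by rewrite -PE -NE -!EFinM -EFinB /= mulrBr.
Qed.

Lemma ge0_integral_translate (f : R -> R) (c : R) :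
  continuous f -> (forall x, 0 <= f x) ->
  (\int[mu]_x (f x)%:E = \int[mu]_x (f (x + c))%:E)%E.
Proof.
move=> cf f0.
have dF (x : R) : is_derive x 1 (fun x => x + c) 1.
  by apply: is_derive_eq; rewrite addr0.
have F'E : ((fun x : R => x + c)^`())%classic = cst 1.
  apply/funext => x; rewrite derive1E.
  by have := dF x => ?; rewrite derive_val.
rewrite (@increasing_ge0_integration_by_substitutionT _ (fun x => x + c)).
- by apply: eq_integral => x _; rewrite F'E !fctE mulr1.
- by move=> x y; rewrite ltrD2r.
- by rewrite F'E => x; exact: cvg_cst.
- by rewrite F'E; exact: (is_cvg_cst (1 : R)).
- by rewrite F'E; exact: (is_cvg_cst (1 : R)).
- by move=> x; have [] := dF x.
- apply/cvgrNyPle => A; exists (A - c); split; first exact: num_real.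
  by move=> x /=; lra.
- apply/cvgryPge => A; exists (A - c); split; first exact: num_real.
  by move=> x /=; lra.
- exact: cf.
- exact: f0.
Qed.

End scaling.

(** * Gaussian integrals on the line *)

Section gaussian1.
Context {R : realType}.
Local Notation mu := (@lebesgue_measure R).

Lemma continuous_exp_normr : continuous (fun x : R => expR (- `|x|)).
Proof.
move=> x; apply: (continuous_comp (f := fun x : R => - `|x|)).
  by apply: cvgN; exact: norm_continuous.
exact: continuous_expR.
Qed.

(** The fundamental theorem of calculus on a half-line is applied to functions
of constant sign; adding the majorant K exp(-|x|), whose primitive is explicit,
makes the integrand nonnegative, and evenness brings back the whole line. *)
Lemma integral_even_derivative_majorant (f F : R -> R) (K : R) :
  continuous f -> (forall x, f (- x) = f x) ->
  (forall x, `|f x| <= K * expR (- `|x|)) ->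
  (forall x : R, is_derive x 1 F (f x)) -> F 0 = 0 ->
  F x @[x --> +oo%R] --> (0 : R) ->
  (\int[mu]_x (f x + K * expR (- `|x|))%:E = (2 * K)%:E)%E.
Proof.
move=> cf ef fK dF F0 Fy.
have cg : continuous (fun x : R => f x + K * expR (- `|x|)).
  move=> x; apply: cvgD; first exact: cf.
  by apply: cvgM; [exact: cvg_cst|exact: continuous_exp_normr].
have g0 x : 0 <= f x + K * expR (- `|x|).
  by have := fK x; rewrite ler_norml => /andP[]; rewrite -subr_ge0 opprK addrC.
rewrite ge0_symfun_integralT//; last by move=> x /=; rewrite ef normrN.
have -> : [set x : R | 0 <= x] = `[0, +oo[%classic by rewrite set_itvcy.
rewrite [X in (2%:E * X)%E](_ : _ = (0:R)%:E - (F 0 - K)%:E)%E; last first.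
  pose G x := F x - K * expR (- x).
  have -> : F 0 - K = G 0 by rewrite /G oppr0 expR0 mulr1.
  have dG (x : R) : is_derive x 1 G (f x + K * expR (- x)).
    have dFx := dF x.
    rewrite /G; apply: is_derive_eq; rewrite /= /GRing.scale/=; ring.
  apply: ge0_continuous_FTC2y.
  - by move=> x _; exact: g0.
  - exact: continuous_subspaceT.
  - rewrite -[X in _ --> X]subr0 -[X in _ - X](mulr0 K).
    by apply: cvgB => //; apply: cvgM; [exact: cvg_cst|exact: cvgr_expR].
  - by move=> x x0; have [] := dG x.
  - apply: cvg_at_right_filter.
    have /derivable1_diffP/differentiable_continuous : derivable G 0 1.
      by have [] := dG 0.
    exact.
  - move=> x; rewrite in_itv/= andbT => x0.
    have dGx := dG x; rewrite derive1E derive_val ger0_norm//; exact: ltW.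
by rewrite F0 sub0r -EFinB sub0r opprK -EFinM.
Qed.

Lemma exp_normr_integral :
  mu.-integrable setT (EFin \o (fun x : R => expR (- `|x|))) /\
  \int[mu]_x expR (- `|x|) = 2.
Proof.
have E : (\int[mu]_x (expR (- `|x|))%:E = 2%:E)%E.
  have H := @integral_even_derivative_majorant (cst 0) (cst 0) 1.
  rewrite -[2]mulr1 -H//.
  - by apply: eq_integral => x _; rewrite add0r mul1r.
  - by move=> x; exact: cvg_cst.
  - by move=> x /=; rewrite normr0 mul1r expR_ge0.
  - exact: cvg_cst.
split; last by rewrite /Rintegral E.
apply/integrableP; split.
  apply/measurable_EFinP; apply: continuous_measurable_fun.
  exact: continuous_exp_normr.
under eq_integral => x _ do rewrite /= ger0_norm ?expR_ge0//.
by rewrite E ltry.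
Qed.

Lemma Rintegral_even_derivative (f F : R -> R) (K : R) :
  continuous f -> (forall x, f (- x) = f x) ->
  (forall x, `|f x| <= K * expR (- `|x|)) ->
  (forall x : R, is_derive x 1 F (f x)) -> F 0 = 0 ->
  F x @[x --> +oo%R] --> (0 : R) ->
  \int[mu]_x f x = 0.
Proof.
move=> cf ef fK dF F0 Fy.
have E := integral_even_derivative_majorant cf ef fK dF F0 Fy.
have [i1 E1] := exp_normr_integral.
have iK := integrableZR (mu := mu) measurableT K i1.
have mf : measurable_fun setT f by exact: continuous_measurable_fun.
have fi : mu.-integrable setT (EFin \o f).
  by apply: le_integrableR iK => // x _; exact: fK.
have : \int[mu]_x (f x + K * expR (- `|x|)) = 2 * K by rewrite /Rintegral E.
rewrite RintegralD// RintegralZl// E1 [K * 2]mulrC => h.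
by apply: (addIr (2 * K)); rewrite add0r.
Qed.

Definition gauss (a x : R) : R := expR (- (a * x ^+ 2)).

Lemma continuous_gauss a : continuous (gauss a).
Proof.
move=> x; apply: (continuous_comp (f := fun x : R => - (a * x ^+ 2))).
  by apply: cvgN; apply: cvgM; [exact: cvg_cst|exact: exprn_continuous].
exact: continuous_expR.
Qed.

Lemma measurable_gauss a : measurable_fun setT (gauss a).
Proof. by apply: continuous_measurable_fun; exact: continuous_gauss. Qed.

Lemma gauss_le1 a x : 0 <= a -> gauss a x <= 1.
Proof. by move=> a0; rewrite -expR0 ler_expR oppr_le0 mulr_ge0// sqr_ge0. Qed.

Lemma gauss_scale a x : 0 <= a -> gauss a x = gauss_fun (Num.sqrt a * x).
Proof. by move=> a0; rewrite /gauss /gauss_fun exprMn sqr_sqrtr. Qed.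

Lemma integrable_gauss a : 0 < a -> mu.-integrable setT (EFin \o gauss a).
Proof.
move=> a0; have sa : 0 < Num.sqrt a by rewrite sqrtr_gt0.
have [+ _] := integrable_scale sa (@integrableT_gauss R).
by apply: eq_integrable => // x _ /=; rewrite gauss_scale// ltW.
Qed.

Lemma integrable_le_gauss (a : R) (K : R) (f : R -> R) : 0 < a ->
  measurable_fun setT f -> (forall x, `|f x| <= K * gauss a x) ->
  mu.-integrable setT (EFin \o f).
Proof.
move=> a0 mf fK.
have i1 := integrableZR (mu := mu) measurableT K (integrable_gauss a0).
by apply: le_integrableR i1 => // x _; exact: fK.
Qed.

Lemma measurable_cosR : measurable_fun setT (@cos R).
Proof. by apply: continuous_measurable_fun; exact: continuous_cos. Qed.

Lemma measurable_sinR : measurable_fun setT (@sin R).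
Proof. by apply: continuous_measurable_fun; exact: continuous_sin. Qed.

Lemma measurable_gauss_trig a xi (tr : R -> R) : measurable_fun setT tr ->
  measurable_fun setT (fun x => gauss a x * tr (x * xi)).
Proof.
move=> mtr; apply: measurable_funM; first exact: measurable_gauss.
by apply: measurableT_comp => //; exact: measurable_funM.
Qed.

Lemma normr_cos_le1 (x : R) : `|cos x| <= 1.
Proof. by rewrite ler_norml cos_geN1 cos_le1. Qed.

Lemma normr_sin_le1 (x : R) : `|sin x| <= 1.
Proof. by rewrite ler_norml sin_geN1 sin_le1. Qed.

Lemma integrable_gauss_trig a xi (tr : R -> R) : 0 < a ->
  measurable_fun setT tr -> (forall t, `|tr t| <= 1) ->
  mu.-integrable setT (EFin \o (fun x => gauss a x * tr (x * xi))).
Proof.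
move=> a0 mtr tr1.
apply: (integrable_le_gauss (K := 1) a0 (measurable_gauss_trig _ _ mtr)) => x.
by rewrite normrM mul1r ger0_norm ?expR_ge0// ler_piMr ?expR_ge0.
Qed.

Definition integrable_gauss_cos a xi (a0 : 0 < a) :=
  integrable_gauss_trig xi a0 measurable_cosR normr_cos_le1.

Definition integrable_gauss_sin a xi (a0 : 0 < a) :=
  integrable_gauss_trig xi a0 measurable_sinR normr_sin_le1.

Lemma Rintegral_gauss_sin a xi : 0 < a ->
  \int[mu]_x (gauss a x * sin (x * xi)) = 0.
Proof.
move=> a0; set f := fun x => _.
have fi : mu.-integrable setT (EFin \o f) by exact: integrable_gauss_sin.
have mN :
    measurable_fun [set: measurableTypeR R] (-%R : _ -> measurableTypeR R).
  exact: oppr_measurable.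
have fN x : f (- x) = - f x by rewrite /f /gauss sqrrN mulNr sinN mulrN.
have fNi : mu.-integrable setT (EFin \o f \o (-%R : _ -> measurableTypeR R)).
  have := integrableN fi; apply: eq_integrable => // x _ /=.
  by rewrite fN EFinN.
have E : \int[mu]_x f x = \int[mu]_x f (- x).
  rewrite /Rintegral; congr fine.
  have /measurable_int mf := fi.
  have := integral_pushforward mN (mu := mu) (D := setT) mf fNi measurableT.
  rewrite preimage_setT => <-; apply: eq_measure_integral => B mB _.
  exact/esym/lebesgue_measureN.
have : \int[mu]_x f x = - \int[mu]_x f x.
  rewrite {1}E -mulN1r -RintegralZl//; apply: eq_Rintegral => x _.
  by rewrite fN mulN1r.
by move=> /eqP; rewrite -subr_eq0 opprK -mulr2n mulrn_eq0 => /eqP.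
Qed.

Lemma Rintegral_gauss a : 0 < a -> \int[mu]_x gauss a x = Num.sqrt (pi / a).
Proof.
move=> a0; have sa : 0 < Num.sqrt a by rewrite sqrtr_gt0.
have [_] := integrable_scale sa (@integrableT_gauss R).
rewrite /Rintegral integralT_gauss/= => H.
rewrite sqrtrM ?pi_ge0// sqrtrV ?ltW// mulrC -H; congr fine.
by apply: eq_integral => x _; rewrite gauss_scale// ltW.
Qed.

Lemma normr_le_sqr2 (x : R) : 2 * `|x| <= 1 + x ^+ 2.
Proof.
have : 0 <= (`|x| - 1) ^+ 2 by exact: sqr_ge0.
by rewrite sqrrB expr1n mulr1 real_normK ?num_real//; lra.
Qed.

Lemma normr_le_exp_sqr (x : R) : `|x| <= expR (x ^+ 2 / 2).
Proof.
apply: le_trans (expR_ge1Dx _).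
by have := normr_le_sqr2 x; lra.
Qed.

(** Integration by parts: the integrand is the derivative of
exp(-x^2) sin(x xi). *)
Lemma gauss_parts (xi : R) :
  \int[mu]_x (gauss 1 x * (xi * cos (x * xi) - 2 * x * sin (x * xi))) = 0.
Proof.
have ccos : continuous (fun x : R => cos (x * xi)).
  move=> x; apply: (continuous_comp (f := fun x : R => x * xi)).
    exact: mulrr_continuous.
  exact: continuous_cos.
have csin : continuous (fun x : R => sin (x * xi)).
  move=> x; apply: (continuous_comp (f := fun x : R => x * xi)).
    exact: mulrr_continuous.
  exact: continuous_sin.
(* The constant comes from 2|x| - x^2 <= 1 and
   |xi| + 2|x| <= (|xi| + 2) e^|x|. *)
apply: (Rintegral_even_derivative (F := fun x => gauss 1 x * sin (x * xi))
  (K := (`|xi| + 2) * expR 1)).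
- move=> x; apply: cvgM; first exact: continuous_gauss.
  apply: cvgB; first by apply: cvgM; [exact: cvg_cst|exact: ccos].
  apply: cvgM; last exact: csin.
  by apply: cvgM; [exact: cvg_cst|exact: cvg_id].
- by move=> x; rewrite /gauss sqrrN !mulNr cosN sinN; ring.
- move=> x.
  rewrite normrM (ger0_norm (expR_ge0 _)).
  have h1 : `|xi * cos (x * xi) - 2 * x * sin (x * xi)| <=
      (`|xi| + 2) * expR `|x|.
    apply: (le_trans (ler_normB _ _)); rewrite !normrM.
    have := normr_cos_le1 (x * xi); have := normr_sin_le1 (x * xi).
    have e1 : 1 <= expR `|x| by rewrite -expR0 ler_expR.
    have e2 : `|x| <= expR `|x|.
      by apply: le_trans (expR_ge1Dx _); rewrite lerDr.
    move=> s1 c1; rewrite mulrDl lerD//.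
      rewrite ler_wpM2l//; exact: le_trans c1 _.
    rewrite (ger0_norm (ler0n _ 2)) -mulrA ler_wpM2l//.
    by apply: le_trans e2; rewrite ler_piMr.
  apply: (le_trans (ler_wpM2l (expR_ge0 _) h1)).
  rewrite mulrCA -mulrA ler_wpM2l ?addr_ge0//.
  rewrite /gauss -!expRD ler_expR mul1r.
  by have := normr_le_sqr2 x; lra.
- move=> x; rewrite /gauss; apply: is_derive_eq.
  rewrite /GRing.scale/=; ring.
- by rewrite mul0r sin0 mulr0.
- apply: norm_cvg0.
  have g0 : gauss 1 x @[x --> +oo%R] --> (0 : R).
    have -> : gauss 1 = @gauss_fun R by apply/funext => x; rewrite /gauss mul1r.
    exact: cvg_gauss_fun.
  apply: squeeze_cvgr (cvg_cst _) g0.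
  apply: nearW => x; rewrite /= normr_ge0 normrM (ger0_norm (expR_ge0 _)).
  by rewrite ler_piMr ?expR_ge0// normr_sin_le1.
Qed.

Let gcos (xi x : R) := gauss 1 x * cos (x * xi).

Let is_derive_gcos (x xi : R) :
  is_derive xi 1 (gcos ^~ x) (- (x * gauss 1 x * sin (x * xi))).
Proof.
rewrite /gcos; apply: is_derive_eq; rewrite /GRing.scale/=; ring.
Qed.

Let gcosE (xi x : R) : partial1of2 gcos xi x = - (x * gauss 1 x * sin (x * xi)).
Proof.
by rewrite partial1of2E; have d := is_derive_gcos x xi; rewrite derive_val.
Qed.

Let gcos_bound (x xi : R) : `|x * gauss 1 x * sin (x * xi)| <= gauss 2^-1 x.
Proof.
rewrite normrM (@le_trans _ _ (`|x * gauss 1 x|))//.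
  by rewrite ler_piMr// normr_sin_le1.
rewrite normrM (ger0_norm (expR_ge0 _)).
apply: (le_trans (ler_wpM2r (expR_ge0 _) (normr_le_exp_sqr x))).
by rewrite /gauss -expRD ler_expR; lra.
Qed.

(** Differentiating under the integral sign and integrating by parts gives
F' = -(xi/2) F for the cosine integral F, hence F(xi) exp(xi^2/4) is
constant. *)
Lemma Rintegral_gauss1_cos (xi : R) :
  \int[mu]_x (gauss 1 x * cos (x * xi)) = Num.sqrt pi * expR (- (xi ^+ 2 / 4)).
Proof.
pose F (xi : R) := \int[mu]_x (gcos xi x).
have xI (z : R) : `]z - 1, z + 1[%classic z by rewrite /= in_itv/=; lra.
have G0 (x : R) : 0 <= gauss 2^-1 x by exact: expR_ge0.
have dF (z : R) : is_derive z 1 F (- (z / 2) * F z).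
  have dd x y : `]z - 1, z + 1[%classic x -> setT y -> derivable (gcos^~ y) x 1.
    by move=> _ _; have [] := is_derive_gcos y x.
  have ub x y : `]z - 1, z + 1[%classic x -> setT y ->
      `|partial1of2 gcos x y| <= gauss 2^-1 y.
    by move=> _ _; rewrite gcosE normrN; exact: gcos_bound.
  have ih2 : (0:R) < 2^-1 by rewrite invr_gt0.
  have iz y (_ : `]z - 1, z + 1[%classic y) := @integrable_gauss_cos 1 y ltr01.
  have ig := integrable_gauss ih2.
  have H1 := derivable_under_integral (mu := mu) measurableT (xI z) iz dd G0
    ig ub.
  have H2 := differentiation_under_integral (mu := mu) measurableT (xI z) iz dd
    G0 ig ub.
  have msin : measurable_fun setT (fun x : R => x * gauss 1 x * sin (x * z)).
    under eq_fun do rewrite -mulrA.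
    apply: measurable_funM => //.
    exact: measurable_gauss_trig measurable_sinR.
  have isin :
      mu.-integrable setT (EFin \o (fun x => x * gauss 1 x * sin (x * z))).
    apply: (integrable_le_gauss (K := 1) ih2 msin) => x.
    by rewrite mul1r; exact: gcos_bound.
  have icos := @integrable_gauss_cos 1 z ltr01.
  have P := gauss_parts z.
  have P2 : z * F z - 2 * (\int[mu]_x (x * gauss 1 x * sin (x * z))) = 0.
    rewrite -[RHS]P -!RintegralZl// -RintegralB//=; last 2 first.
    - exact: (integrableZR (mu := mu) measurableT).
    - exact: (integrableZR (mu := mu) measurableT).
    by apply: eq_Rintegral => x _; rewrite /gcos; ring.
  apply: DeriveDef; first exact: H1.
  rewrite -derive1E H2.
  transitivity (\int[mu]_x (-1 * (x * gauss 1 x * sin (x * z)))).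
    by apply: eq_Rintegral => x _; rewrite gcosE mulN1r.
  rewrite RintegralZl//; lra.
pose G (z : R) := F z * expR (z ^+ 2 / 4).
have dG (z : R) : is_derive z 1 G 0.
  have dFz := dF z.
  rewrite /G; apply: is_derive_eq; rewrite /GRing.scale/=; lra.
have : G xi = G 0 by apply: is_derive_0_is_cst.
rewrite /G expr0n mul0r expR0 mulr1.
have -> : F 0 = Num.sqrt pi.
  rewrite -[in RHS](divr1 pi) -Rintegral_gauss//; apply: eq_Rintegral => x _.
  by rewrite /gcos mulr0 cos0 mulr1.
move=> <-; rewrite -mulrA -expRD subrr expR0 mulr1//.
Qed.

Lemma Rintegral_gauss_cos a (xi : R) : 0 < a ->
  \int[mu]_x (gauss a x * cos (x * xi)) =
  Num.sqrt (pi / a) * expR (- (xi ^+ 2 / (4 * a))).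
Proof.
move=> a0; have sa : 0 < Num.sqrt a by rewrite sqrtr_gt0.
have [_ H] :=
  integrable_scale sa (integrable_gauss_cos (xi / Num.sqrt a) ltr01).
transitivity (\int[mu]_x (gauss 1 (Num.sqrt a * x) *
    cos (Num.sqrt a * x * (xi / Num.sqrt a)))).
  apply: eq_Rintegral => x _; congr (_ * _).
    by rewrite /gauss mul1r exprMn sqr_sqrtr// ltW.
  by congr cos; field; rewrite gt_eqF.
rewrite H Rintegral_gauss1_cos sqrtrM ?pi_ge0// sqrtrV ?ltW// mulrCA mulrA.
congr (_ * expR (- _)).
by rewrite expr_div_n sqr_sqrtr ?ltW//; field; rewrite gt_eqF.
Qed.

End gaussian1.

(** * Gaussians on R^n and their Fourier transforms *)

Section gaussian.
Context {R : realType}.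
Local Notation mu := (@lebesgue_measure R).
Local Notation leb := (lebesgue_rV R).

Definition gaussn n (a : R) (x : 'rV[R]_n) : R := expR (- (a * dotp x x)).

Lemma dotp_recl n (x y : 'rV[R]_n.+1) :
  dotp x y = x ord0 ord0 * y ord0 ord0 + dotp (rV_tail x) (rV_tail y).
Proof.
rewrite /dotp big_ord_recl; congr (_ + _).
by apply: eq_bigr => i _; rewrite !mxE.
Qed.

Lemma dotp_ge0 n (x : 'rV[R]_n) : 0 <= dotp x x.
Proof. by apply: sumr_ge0 => i _; rewrite -expr2 sqr_ge0. Qed.

Lemma enorm2 n (x : 'rV[R]_n) : enorm x ^+ 2 = dotp x x.
Proof. by rewrite sqr_sqrtr// dotp_ge0. Qed.

Lemma gaussn_recl n a (x : 'rV[R]_n.+1) :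
  gaussn a x = gauss a (x ord0 ord0) * gaussn a (rV_tail x).
Proof. by rewrite /gaussn /gauss dotp_recl -expRD mulrDr opprD expr2. Qed.

Lemma gaussn_le1 n a (x : 'rV[R]_n) : 0 <= a -> gaussn a x <= 1.
Proof. by move=> a0; rewrite -expR0 ler_expR oppr_le0 mulr_ge0// dotp_ge0. Qed.

Lemma gaussnD n a b (x : 'rV[R]_n) : gaussn (a + b) x = gaussn a x * gaussn b x.
Proof. by rewrite /gaussn -expRD mulrDl opprD. Qed.

Lemma measurable_dotpr n (y : 'rV[R]_n) :
  measurable_fun setT (fun x => dotp x y).
Proof.
apply: measurable_sum => i; apply: measurable_funM => //.
exact: measurable_coord.
Qed.

Lemma measurable_dotp n : measurable_fun setT (fun x : 'rV[R]_n => dotp x x).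
Proof.
by apply: measurable_sum => i; apply: measurable_funM; exact: measurable_coord.
Qed.

Lemma measurable_enorm n : measurable_fun setT (@enorm R n).
Proof.
rewrite (_ : @enorm R n = Num.sqrt \o (fun x => dotp x x))//.
apply: measurableT_comp; last exact: measurable_dotp.
by apply: continuous_measurable_fun; exact: sqrt_continuous.
Qed.

Lemma measurable_gaussn n a : measurable_fun setT (@gaussn n a).
Proof.
rewrite (_ : @gaussn n a =
  (fun t : R => expR (- (a * t))) \o (fun x => dotp x x))//.
apply: measurableT_comp; last exact: measurable_dotp.
by apply: measurableT_comp => //; apply: measurableT_comp.
Qed.

Lemma measurable_cos_dotp n (xi : 'rV[R]_n) :
  measurable_fun setT (fun x => cos (dotp x xi)).
Proof.
exact: measurableT_comp measurable_cosR (measurable_dotpr xi).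
Qed.

Lemma rV0_eq0 (x : 'rV[R]_0) : x = 0.
Proof. by apply/rowP => -[]. Qed.

Lemma dotp_rV0 (x y : 'rV[R]_0) : dotp x y = 0.
Proof. by rewrite /dotp big_ord0. Qed.

Lemma integral_rV0 (f : 'rV[R]_0 -> R) :
  (leb 0).-integrable setT (EFin \o f) /\ \int[leb 0]_x f x = f 0.
Proof.
have fE : f = cst (f 0) by apply/funext => x; rewrite /cst (rV0_eq0 x).
have mf : measurable_fun setT f by rewrite fE.
split.
  apply/integrableP; split; first exact/measurable_EFinP.
  rewrite (_ : integral _ _ _ =
    \int[\d_(0%R : 'rV[R]_0)]_x `|(EFin \o f) x|)%E//.
  rewrite integral_dirac//; first by rewrite diracT mul1e ltry.
  by apply: measurableT_comp => //; exact/measurable_EFinP.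
transitivity (fine (\int[\d_(0%R : 'rV[R]_0)]_x (EFin \o f) x)%E) => //.
rewrite integral_dirac//; first by rewrite diracT mul1e.
exact/measurable_EFinP.
Qed.

(** The tensor product of the one-dimensional formulas: by induction on the
dimension, the addition formulas for cos and sin split off one coordinate. *)
Lemma gaussn_trig n a (xi : 'rV[R]_n) : 0 < a ->
  [/\ (leb n).-integrable setT
        (EFin \o (fun x => gaussn a x * cos (dotp x xi))),
      (leb n).-integrable setT
        (EFin \o (fun x => gaussn a x * sin (dotp x xi))),
      \int[leb n]_x (gaussn a x * cos (dotp x xi)) =
        Num.sqrt (pi / a) ^+ n * gaussn (4 * a)^-1 xi &
      \int[leb n]_x (gaussn a x * sin (dotp x xi)) = 0].
Proof.
move=> a0; elim: n xi => [|n ih] xi.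
  have [i1 v1] := integral_rV0 (fun x => gaussn a x * cos (dotp x xi)).
  have [i2 v2] := integral_rV0 (fun x => gaussn a x * sin (dotp x xi)).
  split=> //; rewrite ?v1 ?v2 /gaussn !dotp_rV0 ?mulr0 ?oppr0 ?expR0//.
  + by rewrite cos0 mulr1.
  + by rewrite sin0 mulr0.
have [i1 i2 v1 v2] := ih (rV_tail xi).
have j1 := integrable_gauss_cos (xi ord0 ord0) a0.
have j2 := integrable_gauss_sin (xi ord0 ord0) a0.
have [k11 w11] := integrable_tensor j1 i1.
have [k12 w12] := integrable_tensor j1 i2.
have [k21 w21] := integrable_tensor j2 i1.
have [k22 w22] := integrable_tensor j2 i2.
have Ec : (fun x : 'rV_n.+1 => gaussn a x * cos (dotp x xi)) = (fun x =>
    (gauss a (x ord0 ord0) * cos (x ord0 ord0 * xi ord0 ord0)) *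
      (gaussn a (rV_tail x) * cos (dotp (rV_tail x) (rV_tail xi))) -
    (gauss a (x ord0 ord0) * sin (x ord0 ord0 * xi ord0 ord0)) *
      (gaussn a (rV_tail x) * sin (dotp (rV_tail x) (rV_tail xi)))).
  by apply/funext => x; rewrite gaussn_recl dotp_recl cosD; ring.
have Es : (fun x : 'rV_n.+1 => gaussn a x * sin (dotp x xi)) = (fun x =>
    (gauss a (x ord0 ord0) * cos (x ord0 ord0 * xi ord0 ord0)) *
      (gaussn a (rV_tail x) * sin (dotp (rV_tail x) (rV_tail xi))) +
    (gauss a (x ord0 ord0) * sin (x ord0 ord0 * xi ord0 ord0)) *
      (gaussn a (rV_tail x) * cos (dotp (rV_tail x) (rV_tail xi)))).
  by apply/funext => x; rewrite gaussn_recl dotp_recl sinD; ring.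
rewrite Ec Es; split.
- exact: (integrableBR (mu := leb n.+1)).
- exact: (integrableDR (mu := leb n.+1)).
- rewrite RintegralB// w11 w22 v1 v2 mulr0 subr0 Rintegral_gauss_cos//.
  rewrite [_ ^+ n.+1]exprS gaussn_recl [LHS]mulrACA; congr (_ * (_ * _)).
  by rewrite /gauss [in RHS]mulrC.
- by rewrite RintegralD// w12 w21 v2 Rintegral_gauss_sin// mulr0 mul0r addr0.
Qed.

Lemma dotp0r n (x : 'rV[R]_n) : dotp x 0 = 0.
Proof. by rewrite /dotp big1// => i _; rewrite mxE mulr0. Qed.

Lemma integrable_gaussn n a : 0 < a ->
  (leb n).-integrable setT (EFin \o @gaussn n a).
Proof.
move=> a0; have [+ _ _ _] := gaussn_trig (0 : 'rV[R]_n) a0.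
by apply: eq_integrable => // x _ /=; rewrite dotp0r cos0 mulr1.
Qed.

Lemma Rintegral_gaussn n a : 0 < a ->
  \int[leb n]_x gaussn a x = Num.sqrt (pi / a) ^+ n.
Proof.
move=> a0; have [_ _ + _] := gaussn_trig (0 : 'rV[R]_n) a0.
rewrite {2}/gaussn dotp0r mulr0 oppr0 expR0 mulr1 => <-.
by apply: eq_Rintegral => x _; rewrite dotp0r cos0 mulr1.
Qed.

Lemma integrable_le_gaussn n (a : R) (K : R) (f : 'rV[R]_n -> R) : 0 < a ->
  measurable_fun setT f -> (forall x, `|f x| <= K * gaussn a x) ->
  (leb n).-integrable setT (EFin \o f).
Proof.
move=> a0 mf fK; apply: (le_integrableR measurableT mf) => [x _|].
  exact: fK.
exact: (integrableZR (mu := leb n) measurableT K (integrable_gaussn n a0)).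
Qed.

Lemma dotpC n (x y : 'rV[R]_n) : dotp x y = dotp y x.
Proof. by apply: eq_bigr => i _; rewrite mulrC. Qed.

Lemma dotpNr n (x y : 'rV[R]_n) : dotp x (- y) = - dotp x y.
Proof. by rewrite /dotp -sumrN; apply: eq_bigr => i _; rewrite mxE mulrN. Qed.

Lemma gaussnN n a (x : 'rV[R]_n) : gaussn a (- x) = gaussn a x.
Proof. by rewrite /gaussn dotpNr dotpC dotpNr opprK. Qed.

End gaussian.

Section fourier.
Context {R : realType} {d : nat}.
Local Open Scope complex_scope.
Local Notation leb := (lebesgue_rV R d).
Implicit Types (x xi : 'rV[R]_d) (a c : nat -> R) (s : seq nat).

Lemma real_cisE (r t : R) : r%:C * cis t = (r * cos t) +i* (r * sin t).
Proof. by apply/eqP; rewrite eq_complex /= !mul0r subr0 addr0 !eqxx. Qed.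

Lemma Cintegral_real_cis (h : 'rV[R]_d -> R) xi :
  Cintegral setT (fun x => (h x)%:C * cis (dotp x xi)) =
  (\int[leb]_x (h x * cos (dotp x xi))) +i*
  (\int[leb]_x (h x * sin (dotp x xi))).
Proof.
by rewrite /Cintegral; congr (_ +i* _); apply: eq_Rintegral => x _;
  rewrite real_cisE.
Qed.

(** The functions f, g and f g are all finite sums of Gaussians. *)
Definition gsum s c a x : R := \sum_(k <- s) c k * gaussn (a k) x.

Definition gsum_hat s c a xi : R :=
  \sum_(k <- s) c k * (Num.sqrt (pi / a k) ^+ d * gaussn (4 * a k)^-1 xi).

Lemma fourier_gsum s c a xi : (forall k, 0 < a k) ->
  fourier (fun x => (gsum s c a x)%:C) xi = (gsum_hat s c a xi)%:C.
Proof.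
move=> a0; rewrite /fourier.
under [X in Cintegral _ X]funext => x do rewrite -dotpNr.
rewrite Cintegral_real_cis /gsum_hat /gsum.
have H k := gaussn_trig (- xi) (a0 k).
congr (_ +i* _).
  under eq_Rintegral => x _ do rewrite mulr_suml.
  have [|_ ->] := @integrable_sumR _ _ _ leb setT measurableT _ s
    (fun k x => c k * gaussn (a k) x * cos (dotp x (- xi))).
    move=> k; under [X in _ \o X]funext => x do rewrite -mulrA.
    by apply: integrableZR => //; have [] := H k.
  apply: eq_bigr => k _; under eq_Rintegral do rewrite -mulrA.
  by have [i1 _ i2 _] := H k; rewrite RintegralZl// i2 gaussnN.
under eq_Rintegral => x _ do rewrite mulr_suml.
have [|_ ->] := @integrable_sumR _ _ _ leb setT measurableT _ s
  (fun k x => c k * gaussn (a k) x * sin (dotp x (- xi))).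
  move=> k; under [X in _ \o X]funext => x do rewrite -mulrA.
  by apply: integrableZR => //; have [] := H k.
rewrite big1// => k _; under eq_Rintegral do rewrite -mulrA.
by have [_ i1 _ i2] := H k; rewrite RintegralZl// i2 mulr0.
Qed.

(** The transform of a Gaussian sum is an explicit real Gaussian sum, so applying
a multiplier amounts to one cosine and one sine integral. *)
Lemma fourier_multiplier_gsum m s c a x : (forall k, 0 < a k) ->
  fourier_multiplier m (fun x => (gsum s c a x)%:C) x =
  (((2 * pi) ^+ d)^-1 *
    \int[leb]_xi (m xi * gsum_hat s c a xi * cos (dotp xi x))) +i*
  (((2 * pi) ^+ d)^-1 *
    \int[leb]_xi (m xi * gsum_hat s c a xi * sin (dotp xi x))).
Proof.
move=> a0; rewrite /fourier_multiplier /inverse_fourier.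
under [X in Cintegral _ X]funext => xi do
  rewrite fourier_gsum// dotpC -rmorphM.
rewrite Cintegral_real_cis.
by apply/eqP; rewrite eq_complex /= !mul0r subr0 addr0 !eqxx.
Qed.

End fourier.

(** * Gaussian sums are Schwartz functions *)

Section normc.
Context {R : realType}.
Local Open Scope complex_scope.
Local Notation normc := (@Normc.normc R).

Lemma normc_leD (u v : R) : normc (u +i* v) <= `|u| + `|v|.
Proof.
rewrite /normc -[leRHS]ger0_norm ?addr_ge0// -sqrtr_sqr ler_wsqrtr//.
rewrite sqrrD !real_normK ?num_real// addrAC lerDl.
by rewrite mulrn_wge0// mulr_ge0.
Qed.

Lemma normr_Re_le (z : R[i]) : `|complex.Re z| <= normc z.
Proof.
case: z => u v /=; rewrite -sqrtr_sqr ler_wsqrtr// lerDl sqr_ge0//.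
Qed.

Lemma normc_real (u : R) : normc u%:C = `|u|.
Proof. by rewrite /normc /= expr0n addr0 sqrtr_sqr. Qed.

End normc.

Section schwartz.
Context {R : realType} {d : nat}.
Local Open Scope complex_scope.
Local Notation V := 'rV[R]_d.

(** Sums of polynomials times Gaussians are stable under differentiation and
bounded, also after multiplication by a polynomial. Both predicates are
inductive because these facts are proved by induction on how the function is
built. *)
Inductive polyfun : (V -> R) -> Prop :=
| polyfun_cst c : polyfun (cst c)
| polyfun_coord i : polyfun (fun x => x ord0 i)
| polyfunD P Q : polyfun P -> polyfun Q -> polyfun (P + Q)
| polyfunM P Q : polyfun P -> polyfun Q -> polyfun (P * Q).

Inductive gauss_poly : (V -> R) -> Prop :=
| gauss_poly_base P a : polyfun P -> 0 < a -> gauss_poly (P * gaussn a)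
| gauss_polyD g h : gauss_poly g -> gauss_poly h -> gauss_poly (g + h).

Lemma polyfun_differentiable P x : polyfun P -> differentiable P x.
Proof.
elim=> {P} [c|i|P Q _ dP _ dQ|P Q _ dP _ dQ].
- exact: differentiable_cst.
- exact: differentiable_coord.
- exact: differentiableD.
- exact: differentiableM.
Qed.

Lemma partial_coord (i j : 'I_d) :
  partial i (fun x : V => x ord0 j) = cst ((delta_mx ord0 i : V) ord0 j).
Proof.
apply/funext => x; rewrite /partial.
have @f : {linear V -> R}.
  by exists (fun N : V => N ord0 j); do 2![eexists]; do ?[constructor];
     rewrite ?mxE// => ? *; rewrite ?mxE//; move=> ?; rewrite !mxE.
rewrite deriveE; last exact: differentiable_coord.
rewrite (_ : (fun x : V => x ord0 j) = f)// diff_lin//.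
exact: coord_continuous.
Qed.

Lemma partialD i (g h : V -> R) : (forall x, differentiable g x) ->
  (forall x, differentiable h x) ->
  partial i (g + h) = partial i g + partial i h.
Proof.
move=> dg dh; apply/funext => x; rewrite /partial fctE.
by apply: deriveD; exact: diff_derivable.
Qed.

Lemma partialM i (g h : V -> R) : (forall x, differentiable g x) ->
  (forall x, differentiable h x) ->
  partial i (g * h) = g * partial i h + h * partial i g.
Proof.
move=> dg dh; apply/funext => x; rewrite /partial !fctE.
by rewrite deriveM//; exact: diff_derivable.
Qed.

Lemma partial_polyfun i P : polyfun P -> polyfun (partial i P).
Proof.
elim=> {P} [c|j|P Q pP iP pQ iQ|P Q pP iP pQ iQ].
- rewrite (_ : partial i _ = cst 0); first exact: polyfun_cst.
  by apply/funext => x; rewrite /partial derive_cst.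
- by rewrite partial_coord; exact: polyfun_cst.
- rewrite partialD; [|by move=> x; exact: polyfun_differentiable..].
  exact: polyfunD.
- rewrite partialM; [|by move=> x; exact: polyfun_differentiable..].
  by apply: polyfunD; exact: polyfunM.
Qed.

Lemma polyfun_sum (I : Type) (s : seq I) (F : I -> V -> R) :
  (forall i, polyfun (F i)) -> polyfun (\sum_(i <- s) F i).
Proof.
move=> pF; elim: s => [|i s ih].
  by rewrite big_nil; exact: (polyfun_cst 0).
by rewrite big_cons; exact: polyfunD.
Qed.

Lemma polyfun_prod (I : Type) (s : seq I) (F : I -> V -> R) :
  (forall i, polyfun (F i)) -> polyfun (\prod_(i <- s) F i).
Proof.
move=> pF; elim: s => [|i s ih].
  by rewrite big_nil; exact: (polyfun_cst 1).
by rewrite big_cons; exact: polyfunM.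
Qed.

Lemma polyfunX P n : polyfun P -> polyfun (P ^+ n).
Proof.
move=> pP; elim: n => [|n ih]; first by rewrite expr0; exact: (polyfun_cst 1).
by rewrite exprS; exact: polyfunM.
Qed.

Let expo a : V -> R := fun x => - (a * dotp x x).

Let polyfun_expo a : polyfun (expo a).
Proof.
rewrite (_ : expo a = cst (- a) *
    \sum_(i < d) (fun x : V => x ord0 i) * (fun x : V => x ord0 i)).
  apply: polyfunM; first exact: polyfun_cst.
  by apply: polyfun_sum => i; apply: polyfunM; exact: polyfun_coord.
by apply/funext => x; rewrite /expo !fctE/= mulNr fct_sumE.
Qed.

Lemma gaussn_differentiable a (x : V) : differentiable (gaussn a) x.
Proof.
rewrite (_ : gaussn a = expR \o expo a)//.
apply: differentiable_comp; first exact: polyfun_differentiable.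
by apply/derivable1_diffP; exact: derivable_expR.
Qed.

Lemma partial_gaussn i a :
  partial i (gaussn a) = partial i (expo a) * gaussn a.
Proof.
apply/funext => x; rewrite /partial fctE deriveE; last first.
  exact: gaussn_differentiable.
have dx : differentiable (expo a) x by exact: polyfun_differentiable.
have de : differentiable (@expR R) (expo a x).
  by apply/derivable1_diffP; exact: derivable_expR.
rewrite (_ : gaussn a = expR \o expo a)// diff_comp//= (deriveE _ dx).
set t : R := 'd (expo a) x _.
transitivity ('d (@expR R) (expo a x) (t *: (1 : R))).
  by congr ('d _ _ _); rewrite /GRing.scale/= mulr1.
by rewrite linearZ/= -deriveE// derive_val.
Qed.

Lemma gauss_poly_differentiable h x : gauss_poly h -> differentiable h x.
Proof.
elim=> {h} [P a pP a0|g h _ dg _ dh]; last exact: differentiableD.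
apply: differentiableM; first exact: polyfun_differentiable.
exact: gaussn_differentiable.
Qed.

Lemma partial_gauss_poly i h : gauss_poly h -> gauss_poly (partial i h).
Proof.
elim=> {h} [P a pP a0|g h gg ig gh ih].
  rewrite partialM; [|by move=> x; exact: polyfun_differentiable|
    by move=> x; exact: gaussn_differentiable].
  rewrite partial_gaussn mulrA [gaussn a * _]mulrC; apply: gauss_polyD.
    apply: gauss_poly_base => //; apply: polyfunM => //.
    exact: partial_polyfun.
  by apply: gauss_poly_base => //; exact: partial_polyfun.
rewrite partialD; [|by move=> x; exact: gauss_poly_differentiable..].
exact: gauss_polyD.
Qed.

Lemma partials_gauss_poly b h : gauss_poly h -> gauss_poly (partials b h).
Proof. by move=> gh; elim: b => //= i b; exact: partial_gauss_poly. Qed.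

(** A polynomial is dominated by every exp(e|x|^2), since 1 + e|x|^2 is. *)
Lemma polyfun_bound P e : polyfun P -> 0 < e ->
  exists2 K, 0 <= K & forall x, `|P x| <= K * gaussn (- e) x.
Proof.
have g1 (e' : R) (x : V) : 0 <= e' -> 1 <= gaussn (- e') x.
  by move=> e0; rewrite -expR0 ler_expR mulNr opprK mulr_ge0// dotp_ge0.
move=> pP; elim: pP e => {P} [c|i|P Q _ bP _ bQ|P Q _ bP _ bQ] e e0.
- exists `|c| => // x; rewrite /cst/=.
  by rewrite -[leLHS]mulr1 ler_wpM2l// g1// ltW.
- have ie : 0 <= (1 + e^-1) by rewrite addr_ge0// invr_ge0 ltW.
  exists (1 + e^-1) => // x.
  have h1 : `|x ord0 i| <= 1 + x ord0 i ^+ 2.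
    by have := normr_le_sqr2 (x ord0 i); have := sqr_ge0 (x ord0 i); lra.
  apply: (le_trans h1).
  have h2 : x ord0 i ^+ 2 <= dotp x x.
    rewrite /dotp (bigD1 i)//= expr2 lerDl sumr_ge0// => j _.
    by rewrite -expr2 sqr_ge0.
  have h3 : 1 + e * dotp x x <= gaussn (- e) x.
    by rewrite /gaussn mulNr opprK; exact: expR_ge1Dx.
  apply: le_trans (ler_wpM2l ie h3).
  apply: (le_trans (lerD (lexx 1) h2)).
  have e1 : e^-1 * e = 1 by rewrite mulVf// gt_eqF.
  have iv : 0 <= e^-1 by rewrite invr_ge0 ltW.
  have dp := dotp_ge0 x.
  rewrite mulrDl mul1r mulrDr mulr1 mulrA e1 mul1r.
  by have := mulr_ge0 (ltW e0) dp; lra.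
- have [K K0 HK] := bP _ e0; have [L L0 HL] := bQ _ e0.
  exists (K + L) => [|x]; first exact: addr_ge0.
  by rewrite fctE mulrDl (le_trans (ler_normD _ _))// lerD.
- have e2 : 0 < e / 2 by rewrite divr_gt0.
  have [K K0 HK] := bP _ e2; have [L L0 HL] := bQ _ e2.
  exists (K * L) => [|x]; first exact: mulr_ge0.
  have -> : - e = - (e / 2) + - (e / 2) by lra.
  by rewrite fctE gaussnD mulrACA normrM ler_pM.
Qed.

Lemma gauss_poly_bound P h : polyfun P -> gauss_poly h ->
  exists K : R, forall x, `|P x * h x| <= K.
Proof.
move=> pP; elim=> {h} [Q a pQ a0|g h _ [K HK] _ [L HL]].
  have [K K0 HK] := polyfun_bound (polyfunM pP pQ) a0.
  exists K => x; rewrite !fctE mulrA normrM (ger0_norm (expR_ge0 _)).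
  have := HK x; rewrite fctE => h1.
  apply: (le_trans (ler_wpM2r (expR_ge0 _) h1)).
  by rewrite -mulrA -gaussnD addNr /gaussn mul0r oppr0 expR0 mulr1.
exists (K + L) => x; rewrite fctE mulrDr (le_trans (ler_normD _ _))// lerD//.
Qed.

Lemma gauss_poly0 : gauss_poly (cst 0).
Proof.
rewrite (_ : cst 0 = cst 0 * gaussn 1).
  by apply: gauss_poly_base => //; exact: polyfun_cst.
by apply/funext => x; rewrite fctE mul0r.
Qed.

Lemma gauss_poly_schwartz h : gauss_poly h -> schwartz (fun x => (h x)%:C).
Proof.
move=> gh.
have g0 := gauss_poly0.
have sm g : gauss_poly g -> smooth g.
  move=> gg b x; apply: gauss_poly_differentiable.
  exact: partials_gauss_poly.
split; [exact: sm|exact: sm|] => al b.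
pose P : V -> R := \prod_(i < d) (fun x : V => x ord0 i) ^+ al i.
have pP : polyfun P.
  by apply: polyfun_prod => i; apply: polyfunX; exact: polyfun_coord.
have [K HK] := gauss_poly_bound pP (partials_gauss_poly b gh).
have [L HL] := gauss_poly_bound pP (partials_gauss_poly b g0).
exists (K + L) => x.
have -> : \prod_(i < d) x ord0 i ^+ al i = P x.
  by rewrite /P fct_prodE; apply: eq_bigr => i _; rewrite fctE.
apply: (le_trans (ler_wpM2l (normr_ge0 _) (normc_leD _ _))).
by rewrite mulrDr -!normrM lerD.
Qed.

Lemma schwartz_gsum s (c a : nat -> R) : (forall k, 0 < a k) ->
  schwartz (fun x : V => (gsum s c a x)%:C).
Proof.
move=> a0; apply: gauss_poly_schwartz.
elim: s => [|k s ih].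
  rewrite (_ : gsum _ _ _ = cst 0); first exact: gauss_poly0.
  by apply/funext => x; rewrite /gsum big_nil.
rewrite (_ : gsum _ _ _ = cst (c k) * gaussn (a k) + gsum s c a).
  by apply: gauss_polyD => //; apply: gauss_poly_base => //; exact: polyfun_cst.
by apply/funext => x; rewrite /gsum big_cons.
Qed.

End schwartz.

(** * Mean oscillation of Gaussian sums *)

Section oscillation.
Context d (T : measurableType d) (R : realType).
Variable mu : {measure set T -> \bar R}.
Variables (Q : set T) (mQ : measurable Q).
Hypotheses (Qoo : (mu Q < +oo)%E) (Q0 : (0 < mu Q)%E).
Implicit Types u v : T -> R.
Local Notation intQ u := (mu.-integrable Q (EFin \o u)).

Definition avgr u : R := (fine (mu Q))^-1 * \int[mu]_(x in Q) u x.
Definition oscr u : R := (fine (mu Q))^-1 * \int[mu]_(x in Q) `|u x - avgr u|.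

Let V0 : 0 < fine (mu Q).
Proof. by rewrite fine_gt0// Q0 Qoo. Qed.

Let iV0 : 0 < (fine (mu Q))^-1.
Proof. by rewrite invr_gt0. Qed.

Lemma integrable_dev u r : intQ u -> intQ (fun x => `|u x - r|).
Proof.
move=> iu; apply: (integrable_normr mQ).
exact: (integrableBR mQ iu (integrable_cstR mQ r Qoo)).
Qed.

Lemma avgr_cst r : avgr (fun=> r) = r.
Proof. by rewrite /avgr Rintegral_cst// mulrCA mulVf ?mulr1// gt_eqF. Qed.

Lemma avgr_le u v : intQ u -> intQ v -> (forall x, Q x -> u x <= v x) ->
  avgr u <= avgr v.
Proof. by move=> iu iv uv; rewrite /avgr ler_pM2l//; exact: le_Rintegral. Qed.

Lemma oscr_le_diam u D : intQ u ->
  (forall x y, Q x -> Q y -> `|u x - u y| <= D) -> oscr u <= D.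
Proof.
move=> iu uD.
rewrite -[leRHS](avgr_cst D); apply: avgr_le => [||x Qx].
- exact: integrable_dev.
- exact: integrable_cstR.
have h1 : avgr u <= u x + D.
  rewrite -[leRHS]avgr_cst; apply: avgr_le => //; first exact: integrable_cstR.
  by move=> y Qy; have := uD _ _ Qx Qy; rewrite ler_norml => /andP[]; lra.
have h2 : u x - D <= avgr u.
  rewrite -[leLHS]avgr_cst; apply: avgr_le => //; first exact: integrable_cstR.
  by move=> y Qy; have := uD _ _ Qx Qy; rewrite ler_norml => /andP[]; lra.
by rewrite ler_norml; apply/andP; split; lra.
Qed.

Lemma avgrD u v : intQ u -> intQ v ->
  avgr (fun x => u x + v x) = avgr u + avgr v.
Proof. by move=> iu iv; rewrite /avgr RintegralD// mulrDr. Qed.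

Lemma oscr_le_avg u : intQ u -> oscr u <= 2 * avgr (fun x => `|u x|).
Proof.
move=> iu.
have iau := integrable_normr mQ iu.
have h : `|avgr u| <= avgr (fun x => `|u x|).
  rewrite /avgr normrM (gtr0_norm iV0) ler_pM2l//.
  exact: le_normr_Rintegral.
apply: (@le_trans _ _ (avgr (fun x => `|u x| + `|avgr u|))).
  apply: avgr_le => [||x _]; first exact: integrable_dev.
    exact: (integrableDR mQ iau (integrable_cstR mQ _ Qoo)).
  exact: ler_normB.
rewrite avgrD// ?avgr_cst; first lra.
exact: integrable_cstR.
Qed.

Lemma oscr_sum (I : Type) (s : seq I) (c : R) (F : I -> T -> R) : 0 <= c ->
  (forall i, intQ (F i)) ->
  oscr (fun x => \sum_(i <- s) c * F i x) <= c * \sum_(i <- s) oscr (F i).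
Proof.
move=> c0 iF.
have icF i : intQ (fun x => c * F i x) by exact: (integrableZR mQ).
have [iS SE] := integrable_sumR mQ s icF.
have avgE : avgr (fun x => \sum_(i <- s) c * F i x) =
    \sum_(i <- s) c * avgr (F i).
  rewrite /avgr SE mulr_sumr; apply: eq_bigr => i _.
  by rewrite RintegralZl// mulrCA.
have iG i : intQ (fun x => c * `|F i x - avgr (F i)|).
  by apply: (integrableZR mQ); exact: integrable_dev.
have [iG' GE] := integrable_sumR mQ s iG.
have -> : c * \sum_(i <- s) oscr (F i) =
    avgr (fun x => \sum_(i <- s) c * `|F i x - avgr (F i)|).
  rewrite /avgr GE !mulr_sumr; apply: eq_bigr => i _.
  by rewrite RintegralZl//; [rewrite mulrCA|exact: integrable_dev].
apply: avgr_le => [||x _].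
- exact: integrable_dev.
- exact: iG'.
rewrite avgE -sumrB; apply: (le_trans (ler_norm_sum _ _ _)).
by apply: ler_sum => i _; rewrite -mulrBr normrM (ger0_norm c0).
Qed.

End oscillation.

Section dyadic.
Context {R : realType}.

(** The terms decay geometrically on both sides of 2^k = L. The first term is
min(L, 1/L) and the others form the same sum for L/2; the induction goes through
for the stronger bounds 2L, and 4 - 2/L when L >= 1. *)
Lemma dyadic_sum_le (N : nat) (L : R) : 0 < L ->
  \sum_(0 <= k < N) Num.min (L / 2 ^+ k) (2 ^+ k / L) <= 4.
Proof.
move=> L0.
pose S N (L : R) := \sum_(0 <= k < N) Num.min (L / 2 ^+ k) (2 ^+ k / L).
suff : S N L <= 2 * L /\ (1 <= L -> S N L <= 4 - 2 / L).
  move=> [h1 h2]; rewrite -/(S N L); case: (lerP 1 L) => [L1|L1].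
    by apply: (le_trans (h2 L1)); rewrite lerBlDr lerDl divr_ge0// ltW.
  by apply: (le_trans h1); lra.
elim: N L L0 => [|N ih] L L0.
  rewrite /S big_geq//; split; first by lra.
  by move=> L1; rewrite subr_ge0 ler_pdivrMr//; lra.
have SS : S N.+1 L = Num.min L L^-1 + S N (L / 2).
  rewrite /S big_nat_recl// expr0 divr1 div1r; congr (_ + _).
  apply: eq_bigr => k _; rewrite exprS.
  by congr Num.min; field; rewrite ?gt_eqF.
have [h1 h2] := ih (L / 2) ltac:(lra).
have m1 : Num.min L L^-1 <= L by rewrite ge_min lexx.
have m2 : Num.min L L^-1 <= L^-1 by rewrite ge_min lexx orbT.
rewrite SS; split; first by lra.
move=> L1; case: (lerP 2 L) => L2.
  have := h2 ltac:(lra).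
  have -> : 2 / (L / 2) = 4 * L^-1 by field; rewrite gt_eqF.
  have iL : 0 <= L^-1 by rewrite invr_ge0 ltW.
  lra.
have : L + 3 * L^-1 <= 4.
  rewrite -(ler_pM2r L0) mulrDl -mulrA mulVf ?gt_eqF//.
  nra.
lra.
Qed.

Lemma gauss1_lipschitz (s t : R) : `|gauss 1 s - gauss 1 t| <= 2 * `|s - t|.
Proof.
wlog st : s t / s <= t.
  move=> H; have [/H//|/H] := orP (le_total s t).
  by rewrite distrC [`|t - s|]distrC.
have dg (x : R) : is_derive x 1 (gauss 1) (- (2 * x) * gauss 1 x).
  by rewrite /gauss; apply: is_derive_eq; rewrite /GRing.scale/=; ring.
have [c _ E] := @MVT_segment R (gauss 1) (fun x => - (2 * x) * gauss 1 x) s t st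
  (fun x _ => dg x) (continuous_subspaceT (@continuous_gauss R 1)).
rewrite distrC E normrM [`|t - s|]distrC ler_wpM2r//.
rewrite normrM normrN normrM (ger0_norm (expR_ge0 _)) ger0_norm//.
rewrite -mulrA ler_piMr//.
apply: (le_trans (ler_wpM2r (expR_ge0 _) (normr_le_exp_sqr c))).
rewrite -expRD -[leRHS]expR0 ler_expR; have := sqr_ge0 c; lra.
Qed.

Lemma gauss_lipschitz (l s t : R) : 0 < l ->
  `|gauss (l ^+ 2) s - gauss (l ^+ 2) t| <= 2 * l * `|s - t|.
Proof.
move=> l0.
have E x : gauss (l ^+ 2) x = gauss 1 (l * x) by rewrite /gauss mul1r exprMn.
rewrite !E (le_trans (gauss1_lipschitz _ _))// -mulrBr normrM (gtr0_norm l0).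
by rewrite mulrA.
Qed.

Lemma gaussn_lipschitz n (l D : R) (x y : 'rV[R]_n) : 0 < l ->
  (forall i, `|x ord0 i - y ord0 i| <= D) ->
  `|gaussn (l ^+ 2) x - gaussn (l ^+ 2) y| <= n%:R * (2 * l * D).
Proof.
move=> l0; elim: n x y => [|n ih] x y xy.
  by rewrite /gaussn !dotp_rV0 subrr normr0 mul0r.
have l2 : 0 <= l ^+ 2 by exact: sqr_ge0.
rewrite !gaussn_recl.
have -> (a b c e : R) : a * b - c * e = (a - c) * b + c * (b - e) by ring.
apply: (le_trans (ler_normD _ _)); rewrite !normrM -natr1 mulrDl mul1r addrC.
apply: lerD.
  rewrite (ger0_norm (expR_ge0 _)).
  apply: (@le_trans _ _
      `|gaussn (l ^+ 2) (rV_tail x) - gaussn (l ^+ 2) (rV_tail y)|).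
    by rewrite ler_piMl// gauss_le1.
  by apply: ih => i; rewrite !mxE.
rewrite (ger0_norm (expR_ge0 _)).
apply: (@le_trans _ _
    `|gauss (l ^+ 2) (x ord0 ord0) - gauss (l ^+ 2) (y ord0 ord0)|).
  by rewrite ler_piMr// gaussn_le1.
apply: (le_trans (gauss_lipschitz _ _ l0)).
by rewrite ler_wpM2l// mulr_ge0// ltW.
Qed.

End dyadic.

Section bmo.
Context {R : realType}.
Local Open Scope complex_scope.
Local Notation leb := (lebesgue_rV R).

Lemma measurable_cube n (a : 'rV[R]_n) l : measurable (cube a l).
Proof.
rewrite (_ : cube a l = \big[setI/setT]_(i < n)
    ((fun v : 'rV[R]_n => v ord0 i) @^-1` `[a ord0 i, a ord0 i + l]%classic)).
  apply: bigsetI_measurable => i _.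
  by rewrite -[X in measurable X]setTI; exact: measurable_coord.
apply/seteqP; split => [v /= Av|v].
  by rewrite -bigcap_seq => i _ /=; rewrite in_itv/=; exact: Av.
rewrite -bigcap_seq => Av i.
by have := Av i; rewrite /= mem_index_enum in_itv/=; exact.
Qed.

Lemma lebesgue_cube n (a : 'rV[R]_n) l : 0 < l ->
  leb n (cube a l) = (l ^+ n)%:E.
Proof.
move=> l0.
have := @lebesgue_rV_box R n (fun i => `[a ord0 i, a ord0 i + l]%classic)
  (fun i => measurable_itv _).
under [X in _ = X -> _]eq_bigr => i _.
  rewrite lebesgue_measure_itv/= lte_fin ltrDl l0 -EFinB addrAC subrr add0r.
  over.
by rewrite prodEFin prodr_const card_ord => <-; congr (leb n _).
Qed.

(** Decay in a single coordinate already gives the bound that is used on cubes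
much larger than the width of the Gaussian. *)
Lemma Rintegral_gaussn_cube n (l s : R) (a : 'rV[R]_n.+1) : 0 < l -> 0 < s ->
  \int[leb n.+1]_(x in cube a l) gaussn s x <= Num.sqrt (pi / s) * l ^+ n.
Proof.
move=> l0 s0.
pose B : set 'rV[R]_n := cube (rV_tail a) l.
have mB : measurable B by exact: measurable_cube.
have LB : leb n B = (l ^+ n)%:E by exact: lebesgue_cube.
have IB : (\int[leb n]_x (\1_B x)%:E = (l ^+ n)%:E)%E.
  by rewrite integral_indic// setIT; exact: LB.
have iB : (leb n).-integrable setT (EFin \o \1_B).
  apply/integrableP; split; first exact/measurable_EFinP/measurable_indic.
  under eq_integral => x _ do rewrite /= ger0_norm//.
  by rewrite IB ltry.
have iu := integrable_gauss s0 (R := R).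
have [it Et] := integrable_tensor iu iB.
have eB : \int[leb n]_x \1_B x = l ^+ n by rewrite /Rintegral IB.
rewrite Rintegral_gauss// eB in Et.
rewrite -Et; apply: le_Rintegral_subset => //.
- exact: measurable_cube.
- exact: integrable_gaussn.
- move=> x Qx; rewrite gaussn_recl ler_wpM2l ?expR_ge0//.
  rewrite indicE mem_set ?gaussn_le1 ?ltW//.
  by move=> i; rewrite !mxE; exact: Qx.
- by move=> x; rewrite mulr_ge0// expR_ge0.
Qed.

Definition gauss_osc_cst n : R := (n%:R * 2) + 2 * Num.sqrt pi.

(** On cubes smaller than the width 1/s the Lipschitz bound is used, on larger
ones the oscillation is at most twice the mean. *)
Lemma oscr_gaussn n (l s : R) (a : 'rV[R]_n.+1) : 0 < l -> 0 < s ->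
  oscr (leb n.+1) (cube a l) (gaussn (s ^+ 2)) <=
  gauss_osc_cst n.+1 * Num.min (s * l) (s * l)^-1.
Proof.
move=> l0 s0.
have mQ := measurable_cube a l.
have LQ := lebesgue_cube a l0.
have Q0 : (0 < leb n.+1 (cube a l))%E by rewrite LQ lte_fin exprn_gt0.
have Qoo : (leb n.+1 (cube a l) < +oo)%E by rewrite LQ ltry.
have s2 : 0 < s ^+ 2 by rewrite exprn_gt0.
have iQ : (leb n.+1).-integrable (cube a l) (EFin \o gaussn (s ^+ 2)).
  exact: (integrableS measurableT _ _ (integrable_gaussn n.+1 s2)).
have L0 : 0 < s * l by rewrite mulr_gt0.
have spi : 0 <= Num.sqrt pi :> R by exact: sqrtr_ge0.
have nn : 0 <= n.+1%:R :> R by [].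
rewrite minr_pMr ?addr_ge0 ?mulr_ge0// le_min; apply/andP; split.
  apply: (@le_trans _ _ (n.+1%:R * (2 * s * l))).
    apply: oscr_le_diam => // x y Qx Qy; apply: gaussn_lipschitz => // i.
    by have := Qx i; have := Qy i; rewrite ler_norml; lra.
  rewrite -!mulrA mulrA (ler_wpM2r (ltW L0))// /gauss_osc_cst lerDl.
  by rewrite mulr_ge0.
apply: (le_trans (oscr_le_avg mQ Qoo Q0 iQ)).
apply: (@le_trans _ _ (2 * Num.sqrt pi * (s * l)^-1)); last first.
  by rewrite ler_wpM2r ?invr_ge0 ?(ltW L0)// lerDr mulr_ge0.
have AE u : avgr (leb n.+1) (cube a l) u =
    (l ^+ n.+1)^-1 * \int[leb n.+1]_(x in cube a l) u x.
  by rewrite /avgr; congr (_^-1 * _); exact: (congr1 fine LQ).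
rewrite -mulrA ler_wpM2l// AE.
under eq_Rintegral => x _ do rewrite ger0_norm ?expR_ge0//.
have H := Rintegral_gaussn_cube a l0 s2.
rewrite ler_pdivrMl ?exprn_gt0//; apply: (le_trans H).
rewrite sqrtrM ?pi_ge0// sqrtrV ?sqr_ge0// sqrtr_sqr gtr0_norm//.
rewrite exprS le_eqVlt; apply/orP; left; apply/eqP; field.
by rewrite !gt_eqF.
Qed.

(** The oscillation on a fixed cube is at most the sum of the contributions of the
dyadic scales, which decay geometrically on both sides of the size of the cube:
the BMO norm is bounded independently of the number N of terms, although the
function has the value c N at 0. *)
Lemma BMO_norm_gsum n (N : nat) (c s : R) : 0 <= c -> 0 < s ->
  (BMO_norm (fun x : 'rV[R]_n.+1 =>
     (gsum (index_iota 0 N) (fun=> c) (fun k => (s / 2 ^+ k) ^+ 2)%R x)%:C) <=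
  (c * (gauss_osc_cst n.+1 * 4))%:E)%E.
Proof.
move=> c0 s0; apply: ge_ereal_sup => _ [a [l [l0 ->]]].
set u := gsum _ _ _.
have mQ := measurable_cube a l.
have LQ := lebesgue_cube a l0.
have Q0 : (0 < leb n.+1 (cube a l))%E by rewrite LQ lte_fin exprn_gt0.
have Qoo : (leb n.+1 (cube a l) < +oo)%E by rewrite LQ ltry.
have sk k : 0 < s / 2 ^+ k by rewrite divr_gt0// exprn_gt0.
have sk2 k : 0 < (s / 2 ^+ k) ^+ 2 by rewrite exprn_gt0.
have iF k : (leb n.+1).-integrable (cube a l)
    (EFin \o gaussn ((s / 2 ^+ k) ^+ 2)).
  exact: (integrableS measurableT _ _ (integrable_gaussn n.+1 (sk2 k))).
have icF k : (leb n.+1).-integrable (cube a l)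
    (EFin \o (fun x => c * gaussn ((s / 2 ^+ k) ^+ 2) x)).
  exact: (integrableZR mQ).
have [iu _] := integrable_sumR mQ (index_iota 0 N) icF.
have -> : mean_oscillation (fun x : 'rV[R]_n.+1 => (u x)%:C) (cube a l) =
    (oscr (leb n.+1) (cube a l) u)%:E.
  rewrite /mean_oscillation /oscr EFinM; congr (_ * _)%E.
  have -> : average (fun x : 'rV[R]_n.+1 => (u x)%:C) (cube a l) =
      (avgr (leb n.+1) (cube a l) u)%:C.
    apply/eqP; rewrite /average /Cintegral eq_complex /=.
    by rewrite /Rintegral/= integral0/= !mulr0 !mul0r subr0 addr0 !eqxx.
  under eq_integral => x _ do rewrite -rmorphB normc_real.
  rewrite /Rintegral fineK//; apply: integrable_fin_num => //.
  exact: (integrable_dev mQ Qoo).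
rewrite lee_fin (le_trans (oscr_sum mQ Qoo Q0 _ c0 iF))// ler_wpM2l//.
have L0 : 0 < s * l by rewrite mulr_gt0.
have K0 : 0 <= gauss_osc_cst n.+1.
  by rewrite /gauss_osc_cst addr_ge0// ?mulr_ge0// sqrtr_ge0.
apply: (@le_trans _ _ (gauss_osc_cst n.+1 *
  \sum_(0 <= k < N) Num.min (s * l / 2 ^+ k) (2 ^+ k / (s * l)))); last first.
  by rewrite ler_wpM2l// dyadic_sum_le.
rewrite mulr_sumr; apply: ler_sum => k _.
apply: (le_trans (oscr_gaussn _ l0 (sk k))).
have -> : s / 2 ^+ k * l = s * l / 2 ^+ k by rewrite mulrAC.
by rewrite invf_div.
Qed.

End bmo.

(** * Subordination: fractional powers from the heat semigroup *)

Section subordination.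
Context {R : realType}.
Local Notation mu := (@lebesgue_measure R).

Lemma integrable_exp_normr (c : R) : 0 < c ->
  mu.-integrable setT (EFin \o (fun y => expR (- (c * `|y|)))).
Proof.
move=> c0.
have [i1 _] := @exp_normr_integral R.
have [+ _] := integrable_scale c0 i1.
by apply: eq_integrable => // x _ /=; rewrite normrM (gtr0_norm c0).
Qed.

(** The integral of (1 - exp(-t w)) t^(-1-sg) over t > 0 is a multiple of w^sg.
This is its integrand after the substitution t = e^y, which turns the scaling in
w into a translation. *)
Definition subord (sg w y : R) : R :=
  (1 - expR (- (expR y * w))) * expR (- (sg * y)).

Lemma continuous_subord sg w : continuous (subord sg w).
Proof.
move=> y; apply: cvgM.
  apply: cvgB; first exact: cvg_cst.
  apply: (continuous_comp (f := fun y : R => - (expR y * w))).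
    by apply: cvgN; apply: cvgM; [exact: continuous_expR|exact: cvg_cst].
  exact: continuous_expR.
apply: (continuous_comp (f := fun y : R => - (sg * y))).
  by apply: cvgN; apply: cvgM; [exact: cvg_cst|exact: cvg_id].
exact: continuous_expR.
Qed.

Lemma subord_ge0 sg w y : 0 <= w -> 0 <= subord sg w y.
Proof.
move=> w0; rewrite mulr_ge0 ?expR_ge0// subr_ge0 -[leRHS]expR0 ler_expR.
by rewrite oppr_le0 mulr_ge0// expR_ge0.
Qed.

(** With t = e^y the left-hand side is min(1, t) t^(-sg); for y < 0 the
inequality amounts to 1 - sg >= sg. *)
Lemma min_expR_le (sg y : R) : 0 <= sg -> sg <= 2^-1 ->
  Num.min 1 (expR y) * expR (- (sg * y)) <= expR (- (sg * `|y|)).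
Proof.
move=> s0 s1; case: (lerP 0 y) => y0.
  by rewrite (ger0_norm y0) ler_piMl ?expR_ge0// ge_min lexx.
rewrite (ltr0_norm y0); apply: (@le_trans _ _ (expR y * expR (- (sg * y)))).
  by rewrite ler_wpM2r ?expR_ge0// ge_min lexx orbT.
rewrite -expRD ler_expR; nra.
Qed.

Lemma subord1_le (sg y : R) : 0 <= sg -> sg <= 2^-1 ->
  subord sg 1 y <= expR (- (sg * `|y|)).
Proof.
move=> s0 s1; apply: le_trans (min_expR_le y s0 s1).
rewrite ler_wpM2r ?expR_ge0// le_min mulr1; apply/andP; split.
  by rewrite gerBl expR_ge0.
by have := expR_ge1Dx (- expR y); lra.
Qed.

Lemma integrable_subord1 sg : 0 < sg -> sg <= 2^-1 ->
  mu.-integrable setT (EFin \o subord sg 1).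
Proof.
move=> s0 s1; apply: le_integrableR (integrable_exp_normr s0) => //.
  by apply: continuous_measurable_fun; exact: continuous_subord.
by move=> y _; rewrite ger0_norm ?subord_ge0// subord1_le// ltW.
Qed.

Definition subord_cst sg : R := \int[mu]_y subord sg 1 y.

Lemma subord_cst_gt0 sg : 0 < sg -> sg <= 2^-1 -> 0 < subord_cst sg.
Proof.
move=> s0 s1.
pose A : set R := `[0, 1]%classic.
have mA : measurable A by exact: measurable_itv.
have LA : mu A = 1%:E by rewrite /A lebesgue_measure_itv/= lte01 oppr0 adde0.
pose m := (1 - expR (- 1)) * expR (- sg).
have m0 : 0 < m.
  by rewrite mulr_gt0 ?expR_gt0// subr_gt0 -[ltRHS]expR0 ltr_expR; lra.
have i1 := integrable_subord1 s0 s1.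
apply: (@lt_le_trans _ _ (\int[mu]_(x in A) m)).
  rewrite Rintegral_cst// (_ : fine _ = 1) ?mulr1//.
  exact: (congr1 fine LA).
apply: (@le_trans _ _ (\int[mu]_(x in A) subord sg 1 x)); last first.
  by apply: le_Rintegral_subset => // y; rewrite ?lexx ?subord_ge0.
apply: le_Rintegral => //.
- have Aoo : (mu A < +oo)%E by rewrite LA ltry.
  exact: (integrable_cstR (mu := mu) mA m Aoo).
- exact: (integrableS measurableT).
move=> y; rewrite /A/= in_itv/= => /andP[y0 y1].
rewrite /m /subord mulr1 ler_pM ?expR_ge0//.
- by rewrite lerB// ler_expR lerN2 -expR0 ler_expR.
- rewrite ler_expR; nra.
Qed.

Lemma integral_subord (sg w : R) : 0 < sg -> sg <= 2^-1 -> 0 < w ->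
  mu.-integrable setT (EFin \o subord sg w) /\
  \int[mu]_y subord sg w y = w `^ sg * subord_cst sg.
Proof.
move=> s0 s1 w0.
have E : (\int[mu]_y (subord sg w y)%:E = (w `^ sg * subord_cst sg)%:E)%E.
  have i1 := integrable_subord1 s0 s1.
  have E1 y : subord sg w y = w `^ sg * subord sg 1 (y + ln w).
    rewrite /subord mulr1 expRD lnK ?posrE// /powR gt_eqF// mulrCA -expRD.
    by congr (_ * expR _); ring.
  under eq_integral => y _ do rewrite E1 EFinM.
  rewrite ge0_integralZl//; last 3 first.
  - apply/measurable_EFinP; apply: continuous_measurable_fun => y.
    apply: (continuous_comp (f := fun y => y + ln w)).
      by apply: cvgD; [exact: cvg_id|exact: cvg_cst].
    exact: continuous_subord.
  - by move=> y _; rewrite lee_fin subord_ge0.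
  - by rewrite lee_fin powR_ge0.
  rewrite -ge0_integral_translate; last 2 first.
  - exact: continuous_subord.
  - by move=> y; exact: subord_ge0.
  rewrite EFinM /subord_cst /Rintegral fineK//; exact: integrable_fin_num.
split; last by rewrite /Rintegral E.
apply/integrableP; split.
  apply/measurable_EFinP; apply: continuous_measurable_fun.
  exact: continuous_subord.
under eq_integral => y _ do rewrite /= ger0_norm ?subord_ge0 ?ltW//.
by rewrite E ltry.
Qed.

End subordination.

(** * Decay of the difference of two damped heat kernels *)

Section heat.
Context {R : realType}.
Local Notation mu := (@lebesgue_measure R).
Local Notation leb := (lebesgue_rV R).

(** An integrable majorant with algebraic decay, chosen as a product so that its
integral reduces to dimension one. *)
Definition cauchyn n (x : 'rV[R]_n) : R := \prod_(i < n) (1 + x ord0 i ^+ 2)^-1.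

Lemma cauchyn_gt0 n (x : 'rV[R]_n) : 0 < cauchyn x.
Proof. by apply: prodr_gt0 => i _; rewrite invr_gt0 ltr_pwDl// sqr_ge0. Qed.

Lemma gaussn_prod n b (x : 'rV[R]_n) :
  gaussn b x = \prod_(i < n) gauss b (x ord0 i).
Proof.
rewrite /gaussn /dotp mulr_sumr -sumrN expR_sum; apply: eq_bigr => i _.
by rewrite /gauss expr2.
Qed.

Lemma gauss_le_cauchy (b t : R) : 0 < b ->
  gauss b t <= (1 + b^-1) * (1 + t ^+ 2)^-1.
Proof.
move=> b0; have t2 := sqr_ge0 t.
have t1 : 0 < 1 + t ^+ 2 by rewrite ltr_pwDl.
rewrite ler_pdivlMr// mulrDr mulr1 lerD//; first by rewrite gauss_le1// ltW.
rewrite -(ler_pM2l b0) mulfV ?gt_eqF// mulrCA.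
have h : b * t ^+ 2 <= expR (b * t ^+ 2) by apply: le_trans (expR_ge1Dx _); lra.
apply: (le_trans (ler_wpM2l (expR_ge0 _) h)).
by rewrite -expRD addNr expR0.
Qed.

Lemma gaussn_le_cauchyn n b (x : 'rV[R]_n) : 0 < b ->
  gaussn b x <= (1 + b^-1) ^+ n * cauchyn x.
Proof.
move=> b0; rewrite gaussn_prod /cauchyn -[in X in X * _](card_ord n).
rewrite -prodr_const -big_split/=.
by apply: ler_prod => i _; rewrite expR_ge0 gauss_le_cauchy.
Qed.

(** The function exp(-t (1 - Delta)) applied to the Gaussian exp(-|x|^2). *)
Definition heat n (t : R) (x : 'rV[R]_n) : R :=
  expR (- t) * (Num.sqrt (1 + 4 * t)^-1) ^+ n * gaussn (1 + 4 * t)^-1 x.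

Definition heat_cst n : R :=
  (2 ^+ n + (4 * n%:R) ^+ n) + (41 + 4 * n%:R) * 11 ^+ n.

Let b_bounds (t : R) : 0 <= t ->
  [/\ 0 < (1 + 4 * t)^-1, (1 + 4 * t)^-1 <= 1 & 1 - (1 + 4 * t)^-1 <= 4 * t].
Proof.
move=> t0; have h : 0 < 1 + 4 * t by lra.
split; first by rewrite invr_gt0.
  by rewrite invf_le1//; lra.
rewrite lerBlDr -[leLHS](mulfV (lt0r_neq0 h)) -subr_ge0.
have -> : 4 * t + (1 + 4 * t)^-1 - (1 + 4 * t) / (1 + 4 * t) =
    16 * t ^+ 2 / (1 + 4 * t).
  by field; rewrite gt_eqF.
by rewrite divr_ge0 ?mulr_ge0 ?sqr_ge0// ltW.
Qed.

Lemma heat_ge0 n t (x : 'rV[R]_n) : 0 <= heat t x.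
Proof. by rewrite /heat !mulr_ge0 ?expR_ge0// exprn_ge0// sqrtr_ge0. Qed.

(** The Gaussian spreads as t grows, which costs a power of 1 + 4t; the damping
factor exp(-t) absorbs it. *)
Lemma heat_le n t (x : 'rV[R]_n) : (0 < n)%N -> 0 <= t ->
  heat t x <= (4 * n%:R) ^+ n * cauchyn x.
Proof.
move=> n0 t0; have [b0 b1 _] := b_bounds t0.
have N0 : (0 : R) < n%:R by rewrite ltr0n.
have N1 : (1 : R) <= n%:R by rewrite ler1n.
have s1 : Num.sqrt (1 + 4 * t)^-1 ^+ n <= 1.
  by rewrite exprn_ile1 ?sqrtr_ge0// -[leRHS]sqrtr1 ler_wsqrtr.
apply: (@le_trans _ _ (expR (- t) * gaussn (1 + 4 * t)^-1 x)).
  by rewrite /heat ler_wpM2r ?expR_ge0// ler_piMr ?expR_ge0.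
apply: (le_trans (ler_wpM2l (expR_ge0 _) (gaussn_le_cauchyn x b0))).
rewrite invrK mulrA ler_wpM2r ?(ltW (cauchyn_gt0 _))//.
have h : 1 + (1 + 4 * t) <= 4 * n%:R * expR (t / n%:R).
  apply: (@le_trans _ _ (4 * n%:R * (1 + t / n%:R))); last first.
    by rewrite ler_wpM2l ?expR_ge1Dx// mulr_ge0// ltW.
  have -> : 4 * n%:R * (1 + t / n%:R) = 4 * n%:R + 4 * t.
    by field; rewrite gt_eqF.
  lra.
have h2 : (1 + (1 + 4 * t)) ^+ n <= (4 * n%:R) ^+ n * expR t.
  have -> : expR t = expR (t / n%:R) ^+ n.
    by rewrite -expRM_natl; congr expR; rewrite mulrC divfK// gt_eqF.
  by rewrite -exprMn lerXn2r// ?nnegrE; lra.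
apply: (le_trans (ler_wpM2l (expR_ge0 _) h2)).
by rewrite mulrCA -expRD addNr expR0 mulr1.
Qed.

(** Write heat t = k exp(-b|x|^2), where 1 - k and 1 - b are O(t). Replacing b
by 1 costs a factor |x|^2 and replacing k by 1 costs none; since b >= 1/5, half
of the exponent pays for that factor and the other half for the majorant. *)
Lemma heat_diff_small n t (x : 'rV[R]_n) : 0 <= t -> t <= 1 ->
  `|gaussn 1 x - heat t x| <= (41 + 4 * n%:R) * 11 ^+ n * t * cauchyn x.
Proof.
move=> t0 t1; have [b0 b1 bt] := b_bounds t0.
set b := (1 + 4 * t)^-1 in b0 b1 bt *.
have N0 : (0 : R) <= n%:R by [].
have r0 := dotp_ge0 x.
have b5 : 5^-1 <= b by rewrite /b lef_pV2 ?posrE; lra.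
pose k := expR (- t) * Num.sqrt b ^+ n.
have g10 : gaussn b x <= gaussn 10^-1 x.
  by rewrite ler_expR lerN2 ler_wpM2r//; lra.
have G : gaussn 10^-1 x <= 11 ^+ n * cauchyn x.
  apply: (le_trans (gaussn_le_cauchyn x _)); rewrite ?invr_gt0//.
  by have -> : 1 + 10^-1^-1 = 11 :> R by rewrite invrK; lra.
have k1 : 1 - k <= (1 + 4 * n%:R) * t.
  have sb1 : Num.sqrt b <= 1 by rewrite -[leRHS]sqrtr1 ler_wsqrtr.
  have sb : b <= Num.sqrt b.
    by rewrite -[leLHS]sqr_sqrtr ?(ltW b0)// expr2 ler_piMr ?sqrtr_ge0.
  have be : expR (- (4 * t)) <= b.
    by rewrite expRN /b lef_pV2 ?posrE ?expR_gt0 ?expR_ge1Dx//; lra.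
  have bn : expR (- (4 * t)) ^+ n <= Num.sqrt b ^+ n.
    by rewrite lerXn2r ?nnegrE ?expR_ge0 ?sqrtr_ge0// (le_trans be).
  have : expR (- ((1 + 4 * n%:R) * t)) <= k.
    apply: le_trans (ler_wpM2l (expR_ge0 _) bn).
    rewrite -expRM_natl -expRD (_ : - ((1 + 4 * n%:R) * t) =
      - t + n%:R * - (4 * t)) ?lexx//; ring.
  by have := expR_ge1Dx (- ((1 + 4 * n%:R) * t)); lra.
have k2 : k <= 1.
  rewrite /k mulr_ile1 ?expR_ge0 ?exprn_ge0 ?sqrtr_ge0//.
    by rewrite -[leRHS]expR0 ler_expR; lra.
  by rewrite exprn_ile1 ?sqrtr_ge0// -[leRHS]sqrtr1 ler_wsqrtr.
have d1 : 0 <= gaussn b x - gaussn 1 x.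
  by rewrite subr_ge0 ler_expR lerN2 ler_wpM2r.
have d2 : gaussn b x - gaussn 1 x <= 40 * t * gaussn 10^-1 x.
  have -> : gaussn 1 x = gaussn b x * gaussn (1 - b) x.
    by rewrite -gaussnD addrC subrK.
  have e1 : 1 - gaussn (1 - b) x <= 4 * t * dotp x x.
    have := expR_ge1Dx (- ((1 - b) * dotp x x)); rewrite -/(gaussn (1 - b) x).
    have := ler_wpM2r r0 bt; lra.
  have e2 : dotp x x * gaussn b x <= 10 * gaussn 10^-1 x.
    have h5 : gaussn b x <= gaussn 10^-1 x * gaussn 10^-1 x.
      by rewrite -gaussnD ler_expR lerN2 ler_wpM2r//; lra.
    apply: (le_trans (ler_wpM2l r0 h5)); rewrite mulrA ler_wpM2r ?expR_ge0//.
    have h6 : dotp x x <= 10 * expR (10^-1 * dotp x x).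
      have := expR_ge1Dx (10^-1 * dotp x x); lra.
    apply: (le_trans (ler_wpM2r (expR_ge0 _) h6)).
    by rewrite -mulrA -expRD subrr expR0 mulr1.
  have -> : gaussn b x - gaussn b x * gaussn (1 - b) x =
    gaussn b x * (1 - gaussn (1 - b) x) by ring.
  apply: (le_trans (ler_wpM2l (expR_ge0 _) e1)).
  have -> : gaussn b x * (4 * t * dotp x x) = 4 * t * (dotp x x * gaussn b x).
    by ring.
  have -> : 40 * t * gaussn 10^-1 x = 4 * t * (10 * gaussn 10^-1 x) by ring.
  by rewrite ler_wpM2l//; lra.
have gb0 : 0 <= gaussn b x by exact: expR_ge0.
have d3 : 0 <= gaussn b x - k * gaussn b x.
  by have := ler_wpM2r gb0 k2; lra.
have d4 : gaussn b x - k * gaussn b x <= (1 + 4 * n%:R) * t * gaussn 10^-1 x.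
  have -> : gaussn b x - k * gaussn b x = (1 - k) * gaussn b x by ring.
  by rewrite ler_pM//; lra.
have -> : heat t x = k * gaussn b x by [].
have d5 : `|gaussn 1 x - k * gaussn b x| <=
    (41 + 4 * n%:R) * t * gaussn 10^-1 x.
  rewrite ler_norml; apply/andP.
  have : (41 + 4 * n%:R) * t * gaussn 10^-1 x =
    40 * t * gaussn 10^-1 x + (1 + 4 * n%:R) * t * gaussn 10^-1 x by ring.
  by split; lra.
apply: (le_trans d5).
have -> : (41 + 4 * n%:R) * 11 ^+ n * t * cauchyn x =
  (41 + 4 * n%:R) * t * (11 ^+ n * cauchyn x) by ring.
by rewrite ler_wpM2l// mulr_ge0// addr_ge0// mulr_ge0.
Qed.

(** The factor min(1, t) makes the subordination integral converge at both
ends. *)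
Lemma heat_diff n t (x : 'rV[R]_n) : (0 < n)%N -> 0 <= t ->
  `|gaussn 1 x - heat t x| <= heat_cst n * Num.min 1 t * cauchyn x.
Proof.
move=> n0 t0; have c0 := ltW (cauchyn_gt0 x).
have N0 : 0 <= (4 * n%:R) ^+ n :> R by rewrite exprn_ge0// mulr_ge0.
have M0 : 0 <= (41 + 4 * n%:R) * 11 ^+ n :> R.
  by rewrite mulr_ge0 ?exprn_ge0 ?addr_ge0 ?mulr_ge0.
have hl := heat_le x n0 t0; have h0 := heat_ge0 t x.
case: (leP t 1) => t1.
  apply: (le_trans (heat_diff_small x t0 t1)).
  by rewrite ler_wpM2r// ler_wpM2r// lerDr addr_ge0// exprn_ge0.
have hg := gaussn_le_cauchyn x (@ltr01 R).
have g0 : 0 <= gaussn 1 x by exact: expR_ge0.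
have two : 1 + 1^-1 = 2 :> R by rewrite invr1.
rewrite two in hg.
rewrite mulr1 /heat_cst mulrDl mulrDl.
have := mulr_ge0 M0 c0.
by rewrite ler_norml => M1; apply/andP; split; lra.
Qed.

Lemma heat_cst_ge0 n : 0 <= heat_cst n.
Proof.
by rewrite /heat_cst !addr_ge0// ?mulr_ge0// ?exprn_ge0// ?addr_ge0 ?mulr_ge0.
Qed.

End heat.

(** * Bessel potentials of a Gaussian lie in L^p *)

Section bessel.
Context {R : realType} (n : nat) (sg : R).
Hypotheses (n0 : (0 < n)%N) (s0 : 0 < sg) (s1 : sg <= 2^-1).
Local Notation mu := (@lebesgue_measure R).
Local Notation leb := (lebesgue_rV R).
(* The symbol 1 + |xi|^2 of 1 - Delta. *)
Local Notation om := (fun xi : 'rV[R]_n => 1 + dotp xi xi).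
Local Notation g := (@gaussn R n 4^-1).

Let om_ge1 xi : 1 <= om xi.
Proof. by rewrite lerDl dotp_ge0. Qed.

Let om_gt0 xi : 0 < om xi.
Proof. exact: lt_le_trans (om_ge1 xi). Qed.

Let measurable_om : measurable_fun setT om.
Proof. by apply: measurable_funD => //; exact: measurable_dotp. Qed.

Lemma om_gaussn_le xi : om xi * g xi <= 8 * gaussn 8^-1 xi.
Proof.
have -> : (4^-1 : R) = 8^-1 + 8^-1 by lra.
rewrite gaussnD mulrA ler_wpM2r ?expR_ge0//.
apply: (@le_trans _ _ (8 * expR (8^-1 * dotp xi xi) * gaussn 8^-1 xi)).
  rewrite ler_wpM2r ?expR_ge0//.
  by have := expR_ge1Dx (8^-1 * dotp xi xi); lra.
by rewrite -mulrA -expRD subrr expR0 mulr1.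
Qed.

Lemma subord_le_om xi y : subord sg (om xi) y <= om xi * expR (- (sg * `|y|)).
Proof.
have o1 := om_ge1 xi; have o0 := ltW (om_gt0 xi).
apply: le_trans (ler_wpM2l o0 (min_expR_le y (ltW s0) s1)).
rewrite mulrA ler_wpM2r ?expR_ge0// minr_pMr// le_min mulr1.
apply/andP; split.
  by apply: le_trans o1; rewrite gerBl expR_ge0.
by have := expR_ge1Dx (- (expR y * om xi)); lra.
Qed.

Section swap.
Variables (tr : R -> R) (x : 'rV[R]_n).
Hypotheses (mtr : measurable_fun setT tr) (tr1 : forall t, `|tr t| <= 1).

Let mtrx : measurable_fun setT (fun xi : 'rV[R]_n => tr (dotp xi x)).
Proof. by apply: measurableT_comp => //; exact: measurable_dotpr. Qed.

Let F (z : 'rV[R]_n * measurableTypeR R) : R :=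
  subord sg (om z.1) z.2 * (g z.1 * tr (dotp z.1 x)).

Let measurable_F : measurable_fun setT F.
Proof.
have m1 : measurable_fun setT (fun z : 'rV[R]_n * measurableTypeR R => om z.1).
  exact: (measurableT_comp measurable_om measurable_fst).
have m2 :
    measurable_fun setT (fun z : 'rV[R]_n * measurableTypeR R => (z.2 : R)).
  exact: measurable_snd.
apply: measurable_funM.
  apply: measurable_funM.
    apply: measurable_funB => //; apply: measurableT_comp => //.
    apply: measurableT_comp => //; apply: measurable_funM => //.
    exact: measurableT_comp.
  apply: measurableT_comp => //; apply: measurableT_comp => //.
  exact: measurable_funM.
have mg : measurable_fun setT (fun xi => g xi * tr (dotp xi x)).
  by apply: measurable_funM => //; exact: measurable_gaussn.
exact: (measurableT_comp mg measurable_fst).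
Qed.

Let F_le z : `|F z| <= 8 * gaussn 8^-1 z.1 * expR (- (sg * `|z.2|)).
Proof.
rewrite /F normrM (ger0_norm (subord_ge0 _ _ (ltW (om_gt0 _)))).
rewrite normrM (ger0_norm (expR_ge0 _)).
have e0 : 0 <= expR (- (sg * `|z.2|)) by exact: expR_ge0.
have h1 : g z.1 * `|tr (dotp z.1 x)| <= g z.1 by rewrite ler_piMr ?expR_ge0.
apply: (@le_trans _ _ (om z.1 * expR (- (sg * `|z.2|)) * g z.1)).
  apply: ler_pM => //; last exact: subord_le_om.
    exact: (subord_ge0 sg z.2 (ltW (om_gt0 z.1))).
by rewrite mulrAC ler_wpM2r// om_gaussn_le.
Qed.

Let integrable_g8 : (leb n).-integrable setT
  (EFin \o (fun xi : 'rV[R]_n => 8 * gaussn 8^-1 xi)).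
Proof.
by apply: integrableZR => //; apply: integrable_gaussn; rewrite invr_gt0.
Qed.

Let integrable_gtr a : 0 < a ->
  (leb n).-integrable setT
    (EFin \o (fun xi : 'rV[R]_n => gaussn a xi * tr (dotp xi x))).
Proof.
move=> a0; apply: (integrable_le_gaussn (K := 1) a0).
  by apply: measurable_funM => //; exact: measurable_gaussn.
move=> xi.
by rewrite normrM mul1r (ger0_norm (expR_ge0 _)) ler_piMr// expR_ge0.
Qed.

Lemma integrable_om_gaussn :
  (leb n).-integrable setT
    (EFin \o (fun xi => om xi `^ sg * g xi * tr (dotp xi x))).
Proof.
apply: (integrable_le_gaussn (a := 8^-1) (K := 8)); first by rewrite invr_gt0.
  apply: measurable_funM => //; apply: measurable_funM.
    exact: (measurableT_comp (measurable_powR sg) measurable_om).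
  exact: measurable_gaussn.
move=> xi; apply: le_trans (om_gaussn_le xi).
rewrite normrM (@le_trans _ _ `|om xi `^ sg * g xi|)//.
  by rewrite ler_piMr.
rewrite ger0_norm ?mulr_ge0 ?powR_ge0 ?expR_ge0// ler_wpM2r ?expR_ge0//.
rewrite -[leRHS]powRr1 ?(ltW (om_gt0 _))//.
apply: ler_powR; first exact: om_ge1.
by rewrite (le_trans s1)// invf_le1// ler1n.
Qed.

(** Subordination replaces the power of the symbol by exponentials, which only
change the exponent of the Gaussian; Fubini's theorem moves the integral over
the scale outside. *)
Lemma bessel_swap :
  subord_cst sg * \int[leb n]_xi (om xi `^ sg * g xi * tr (dotp xi x)) =
  \int[mu]_y (expR (- (sg * y)) *
    (\int[leb n]_xi (g xi * tr (dotp xi x)) -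
     expR (- expR y) *
       \int[leb n]_xi (gaussn (4^-1 + expR y) xi * tr (dotp xi x)))).
Proof.
have iF : (leb n \x mu)%E.-integrable setT (EFin \o F).
  have := integrable_prod integrable_g8 (integrable_exp_normr s0).
  by apply: le_integrableR => // z _; exact: F_le.
have iFy xi : mu.-integrable setT (EFin \o (fun y => F (xi, y))).
  have [i _] := integral_subord s0 s1 (om_gt0 xi).
  have := integrableZR (mu := mu) measurableT (g xi * tr (dotp xi x)) i.
  by apply: eq_integrable => // y _ /=; rewrite mulrC.
have FE xi y : F (xi, y) = expR (- (sg * y)) * (g xi * tr (dotp xi x)) -
    expR (- (sg * y)) * expR (- expR y) *
      (gaussn (4^-1 + expR y) xi * tr (dotp xi x)).
  rewrite /F /subord /= gaussnD /gaussn.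
  have -> : expR (- (expR y * (1 + dotp xi xi))) =
     expR (- expR y) * expR (- (expR y * dotp xi xi)).
    by rewrite -expRD; congr expR; ring.
  ring.
have p4 : (0 : R) < 4^-1 by rewrite invr_gt0.
have p4y y : (0 : R) < 4^-1 + expR y by rewrite addr_gt0// expR_gt0.
have iFx y : (leb n).-integrable setT (EFin \o (fun xi => F (xi, y))).
  have i1 := integrableZR (mu := leb n) measurableT (expR (- (sg * y)))
    (integrable_gtr p4).
  have i2 := integrableZR (mu := leb n) measurableT
    (expR (- (sg * y)) * expR (- expR y)) (integrable_gtr (p4y y)).
  have := integrableBR measurableT i1 i2.
  by apply: eq_integrable => // xi _; rewrite /= FE.
have iw := integrable_om_gaussn.
rewrite -RintegralZl//.
transitivity (\int[leb n]_xi \int[mu]_y F (xi, y)).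
  apply: eq_Rintegral => xi _.
  have [i E] := integral_subord s0 s1 (om_gt0 xi).
  transitivity (\int[mu]_y (subord sg (om xi) y * (g xi * tr (dotp xi x)))).
    by rewrite RintegralZr// E; ring.
  by [].
rewrite Rintegral_swap//.
apply: eq_Rintegral => y _.
under eq_Rintegral => xi _ do rewrite FE.
rewrite RintegralB//; last 2 first.
- exact: (integrableZR (mu := leb n) measurableT _ (integrable_gtr p4)).
- exact: (integrableZR (mu := leb n) measurableT _ (integrable_gtr (p4y y))).
rewrite !RintegralZl//; [ring|exact: integrable_gtr..].
Qed.

End swap.

Let K := Num.sqrt (4 * pi) ^+ n : R.

Let sqrt_piV t : 0 <= t -> Num.sqrt (pi / (4^-1 + t)) =
  Num.sqrt (4 * pi) * Num.sqrt (1 + 4 * t)^-1 :> R.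
Proof.
move=> t0; rewrite -sqrtrM; last by rewrite mulr_ge0 ?pi_ge0.
congr Num.sqrt; field; rewrite gt_eqF//=; lra.
Qed.

Let cos_moment t (x : 'rV[R]_n) : 0 <= t ->
  expR (- t) * \int[leb n]_xi (gaussn (4^-1 + t) xi * cos (dotp xi x)) =
  K * heat t x.
Proof.
move=> t0; have a0 : (0 : R) < 4^-1 + t by lra.
have [_ _ -> _] := gaussn_trig x a0.
rewrite sqrt_piV// exprMn /heat /K.
have -> : 4 * (4^-1 + t) = 1 + 4 * t by lra.
ring.
Qed.

(** By bessel_swap the potential is an integral of differences
exp(-|x|^2) - heat t, and heat_diff bounds each of them by a multiple of
cauchyn. *)
Lemma bessel_cos_bound (x : 'rV[R]_n) :
  subord_cst sg * `|\int[leb n]_xi (om xi `^ sg * g xi * cos (dotp xi x))| <=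
  K * heat_cst n * (\int[mu]_y expR (- (sg * `|y|))) * cauchyn x.
Proof.
rewrite -[X in X * _](ger0_norm (ltW (subord_cst_gt0 s0 s1))) -normrM.
rewrite (bessel_swap _ measurable_cosR (@normr_cos_le1 R)).
have c0 := ltW (cauchyn_gt0 x).
have K0 : 0 <= K by rewrite exprn_ge0// sqrtr_ge0.
have E0 : K * heat 0 x = K * gaussn 1 x.
  by rewrite /heat oppr0 expR0 mulr0 addr0 invr1 sqrtr1 expr1n !mul1r.
have E y : expR (- (sg * y)) *
    (\int[leb n]_xi (g xi * cos (dotp xi x)) - expR (- expR y) *
      \int[leb n]_xi (gaussn (4^-1 + expR y) xi * cos (dotp xi x))) =
    K * (expR (- (sg * y)) * (gaussn 1 x - heat (expR y) x)).
  rewrite cos_moment ?expR_ge0//.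
  have := cos_moment x (lexx 0); rewrite oppr0 expR0 mul1r addr0 E0 => ->.
  ring.
under eq_Rintegral => y _ do rewrite E.
have i1 : mu.-integrable setT
    (EFin \o (fun y => K * heat_cst n * cauchyn x * expR (- (sg * `|y|)))).
  by apply: integrableZR => //; exact: integrable_exp_normr.
have bd y : `|K * (expR (- (sg * y)) * (gaussn 1 x - heat (expR y) x))| <=
    K * heat_cst n * cauchyn x * expR (- (sg * `|y|)).
  rewrite normrM (ger0_norm K0) -!mulrA ler_wpM2l//.
  rewrite normrM (ger0_norm (expR_ge0 _)).
  apply: (le_trans (ler_wpM2l (expR_ge0 _) (heat_diff x n0 (expR_ge0 y)))).
  have -> : expR (- (sg * y)) * (heat_cst n * Num.min 1 (expR y) * cauchyn x) =
     heat_cst n * (cauchyn x * (Num.min 1 (expR y) * expR (- (sg * y)))).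
    by ring.
  rewrite ler_wpM2l ?heat_cst_ge0// ler_wpM2l//.
  exact: (min_expR_le y (ltW s0) s1).
have mh : measurable_fun setT
    (fun y : R => K * (expR (- (sg * y)) * (gaussn 1 x - heat (expR y) x))).
  have mw : measurable_fun setT (fun y : R => (1 + 4 * expR y)^-1).
    apply: continuous_measurable_fun => y; apply: cvgV.
      by rewrite gt_eqF// ltr_pwDl// mulr_ge0// expR_ge0.
    apply: cvgD; first exact: cvg_cst.
    by apply: cvgM; [exact: cvg_cst|exact: continuous_expR].
  have msqrt : measurable_fun setT (@Num.sqrt R).
    by apply: continuous_measurable_fun; exact: sqrt_continuous.
  apply: measurable_funM => //; apply: measurable_funM.
    by apply: measurableT_comp => //; apply: measurableT_comp.
  apply: measurable_funB => //; apply: measurable_funM.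
    apply: measurable_funM.
      by apply: measurableT_comp => //; exact: measurableT_comp.
    by apply: measurable_funX; exact: measurableT_comp.
  apply: measurableT_comp => //; apply: measurableT_comp => //.
  exact: measurable_funM.
have ih : mu.-integrable setT
    (EFin \o (fun y => K *
      (expR (- (sg * y)) * (gaussn 1 x - heat (expR y) x)))).
  by apply: le_integrableR i1 => //.
apply: (le_trans (le_normr_Rintegral measurableT ih)).
have -> : K * heat_cst n * (\int[mu]_y expR (- (sg * `|y|))) * cauchyn x =
    \int[mu]_y (K * heat_cst n * cauchyn x * expR (- (sg * `|y|))).
  by rewrite RintegralZl//; [ring|exact: integrable_exp_normr].
apply: le_Rintegral => //.
exact: integrable_normr.
Qed.

Lemma bessel_sin_eq0 (x : 'rV[R]_n) :
  \int[leb n]_xi (om xi `^ sg * g xi * sin (dotp xi x)) = 0.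
Proof.
have := bessel_swap x measurable_sinR (@normr_sin_le1 R).
under [in RHS]eq_Rintegral => y _.
  have p4 : (0 : R) < 4^-1 by rewrite invr_gt0.
  have p4y : (0 : R) < 4^-1 + expR y by rewrite addr_gt0// expR_gt0.
  have [_ _ _ ->] := gaussn_trig x p4.
  have [_ _ _ ->] := gaussn_trig x p4y.
  rewrite mulr0 subr0 mulr0.
  over.
rewrite Rintegral_cst// mul0r => /eqP; rewrite mulf_eq0 => /orP[|/eqP//].
by rewrite gt_eqF// subord_cst_gt0.
Qed.

Lemma bessel_bound : exists2 B : R, 0 <= B & forall x : 'rV[R]_n,
  `|\int[leb n]_xi (om xi `^ sg * g xi * cos (dotp xi x))| <= B * cauchyn x.
Proof.
have c0 := subord_cst_gt0 s0 s1.
exists ((subord_cst sg)^-1 *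
    (K * heat_cst n * (\int[mu]_y expR (- (sg * `|y|))))).
  rewrite mulr_ge0 ?invr_ge0 ?(ltW c0)// mulr_ge0//; last first.
    by apply: Rintegral_ge0 => y _; exact: expR_ge0.
  by rewrite mulr_ge0 ?exprn_ge0 ?sqrtr_ge0 ?heat_cst_ge0.
by move=> x; rewrite -[leRHS]mulrA ler_pdivlMl// bessel_cos_bound.
Qed.

End bessel.

Section Lp.
Context {R : realType}.
Local Notation mu := (@lebesgue_measure R).
Local Notation leb := (lebesgue_rV R).
Local Open Scope complex_scope.

Lemma cauchyn_recl n (x : 'rV[R]_n.+1) :
  cauchyn x = (1 + x ord0 ord0 ^+ 2)^-1 * cauchyn (rV_tail x).
Proof.
rewrite /cauchyn big_ord_recl; congr (_ * _).
by apply: eq_bigr => i _; rewrite !mxE.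
Qed.

Lemma integrable_cauchy :
  mu.-integrable setT (EFin \o (fun x : R => (1 + x ^+ 2)^-1)).
Proof.
have cc := @continuous_oneDsqrV R.
have c0 (x : R) : 0 <= (1 + x ^+ 2)^-1 by rewrite invr_ge0 addr_ge0// sqr_ge0.
apply/integrableP; split.
  by apply/measurable_EFinP; exact: continuous_measurable_fun cc.
under eq_integral => x _ do rewrite /= ger0_norm//.
rewrite ge0_symfun_integralT//; last by move=> x /=; rewrite sqrrN.
rewrite (_ : [set x : R | 0 <= x] = `[0, +oo[%classic); last first.
  by rewrite set_itvcy.
have H := @integral0y_oneDsqr R.
rewrite (_ : integral _ _ _ = (pi / 2)%:E)%E; first by rewrite -EFinM ltry.
exact: H.
Qed.

Lemma integrable_cauchyn n : (leb n).-integrable setT (EFin \o @cauchyn R n).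
Proof.
elim: n => [|n ih]; first by have [] := integral_rV0 (@cauchyn R 0).
have [+ _] := integrable_tensor integrable_cauchy ih.
by apply: eq_integrable => // x _ /=; rewrite cauchyn_recl.
Qed.

Lemma cauchyn_le1 n (x : 'rV[R]_n) : cauchyn x <= 1.
Proof.
apply: prodr_ile1 => i _; rewrite invr_ge0 addr_ge0 ?sqr_ge0//=.
by rewrite invf_le1 ?lerDl ?sqr_ge0// ltr_pwDl// sqr_ge0.
Qed.

(** Since cauchyn is at most 1, its p-th power is at most itself. *)
Lemma Lp_norm_le_cauchyn n (p A : R) (F : 'rV[R]_n -> R[i]) :
  1 <= p -> 0 <= A ->
  (forall x, Normc.normc (F x) <= A * cauchyn x) ->
  (Lp_norm p F <= (A * (\int[leb n]_x cauchyn x) `^ p^-1)%:E)%E.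
Proof.
move=> p1 A0 FA; rewrite /Lp_norm unlock.
have p0 : 0 < p by exact: lt_le_trans p1.
have n0 (z : R[i]) : 0 <= Normc.normc z by case: z => u v; exact: sqrtr_ge0.
set I := \int[leb n]_x cauchyn x.
have I0 : 0 <= I by apply: Rintegral_ge0 => x _; exact: ltW (cauchyn_gt0 x).
have H : (\int[leb n]_x (`|(Normc.normc (F x))%:E| `^ p) <= (A `^ p * I)%:E)%E.
  apply: (@le_trans _ _ (\int[leb n]_x (A `^ p * cauchyn x)%:E)%E).
    apply: ge0_le_integralT => x; first by rewrite poweR_ge0.
    rewrite (_ : (`| _ | `^ p)%E = (`|Normc.normc (F x)| `^ p)%:E)//.
    rewrite lee_fin ger0_norm//.
    have c0 := ltW (cauchyn_gt0 x).
    apply: (@le_trans _ _ ((A * cauchyn x) `^ p)).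
      by apply: ge0_ler_powR; rewrite ?nnegrE ?mulr_ge0// ltW.
    rewrite powRM// ler_wpM2l ?powR_ge0//.
    by apply: ge1r_powR; rewrite ?cauchyn_le1 ?cauchyn_gt0.
  have ic := integrable_cauchyn n.
  rewrite (_ : integral _ _ _ = (\int[leb n]_x (A `^ p * cauchyn x))%:E)%E.
    by rewrite RintegralZl.
  rewrite /Rintegral fineK//; apply: integrable_fin_num => //.
  exact: integrableZR.
apply: (@le_trans _ _ ((A `^ p * I)%:E `^ p^-1)%E).
  apply: gt0_ler_poweR => //.
  - by rewrite invr_ge0 ltW.
  - by rewrite in_itv/= leey andbT integral_ge0// => x _; exact: poweR_ge0.
  - by rewrite in_itv/= leey andbT lee_fin mulr_ge0// powR_ge0.
rewrite poweR_EFin lee_fin powRM ?powR_ge0// -powRrM mulfV ?gt_eqF// powRr1//.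
Qed.

Lemma Lp_norm_bessel n (p s : R) : (0 < n)%N -> 1 <= p -> 0 < s -> s <= 1 ->
  exists2 B : R, 0 <= B & forall e : R, 0 <= e ->
  (Lp_norm p (bessel_potential s
     (fun x : 'rV[R]_n => (gsum [:: 0%N] (fun=> e) (fun=> 1%R) x)%:C)) <=
   (e * B)%:E)%E.
Proof.
move=> n0 p1 s0 s1.
have sg0 : 0 < s / 2 by rewrite divr_gt0.
have sg1 : s / 2 <= 2^-1 by lra.
have [B B0 HB] := bessel_bound n0 sg0 sg1.
pose K : R := ((2 * pi) ^+ n)^-1 * Num.sqrt pi ^+ n.
have K0 : 0 <= K.
  by rewrite mulr_ge0 ?invr_ge0 ?exprn_ge0 ?sqrtr_ge0// mulr_ge0 ?pi_ge0.
exists (K * B * (\int[leb n]_x cauchyn x) `^ p^-1) => [|e e0].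
  by rewrite mulr_ge0 ?powR_ge0// mulr_ge0.
rewrite mulrA; apply: Lp_norm_le_cauchyn => // [|x].
  by rewrite mulr_ge0// mulr_ge0.
rewrite /bessel_potential fourier_multiplier_gsum//.
have E tr xi : (1 + enorm xi ^+ 2) `^ (s / 2) *
      gsum_hat [:: 0%N] (fun=> e) (fun=> 1) xi * tr (dotp xi x) =
    (e * Num.sqrt pi ^+ n) *
      ((1 + dotp xi xi) `^ (s / 2) * gaussn 4^-1 xi * tr (dotp xi x)).
  by rewrite enorm2 /gsum_hat big_cons big_nil addr0 divr1 mulr1; ring.
under eq_Rintegral => xi _ do rewrite (E cos).
under [X in _ +i* (_ * X)]eq_Rintegral => xi _ do rewrite (E sin).
have ic := integrable_om_gaussn sg1 x measurable_cosR (@normr_cos_le1 R).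
have isn := integrable_om_gaussn sg1 x measurable_sinR (@normr_sin_le1 R).
rewrite !RintegralZl// bessel_sin_eq0// !mulr0.
apply: (le_trans (normc_leD _ _)); rewrite normr0 addr0.
set J := Rintegral _ _ _.
have -> : (2 * pi) ^- n * (e * Num.sqrt pi ^+ n * J) = (e * K) * J.
  by rewrite /K; ring.
rewrite normrM (ger0_norm (mulr_ge0 e0 K0)).
have -> : e * (K * B) * cauchyn x = e * K * (B * cauchyn x) by ring.
exact: ler_wpM2l (mulr_ge0 e0 K0) _ _ (HB x).
Qed.

End Lp.

(** * The fractional Laplacian of a Gaussian *)

Section frac.
Context {R : realType} (n : nat) (s : R).
Hypotheses (n0 : (0 < n)%N) (s0 : 0 < s) (s1 : s <= 1).
Local Notation leb := (lebesgue_rV R).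
Local Open Scope complex_scope.
Implicit Types (x xi : 'rV[R]_n) (a t : R).

Lemma enorm_ge0 xi : 0 <= enorm xi. Proof. exact: sqrtr_ge0. Qed.

Lemma powR_le_1Dsqr (u : R) : 0 <= u -> u `^ s <= 1 + u ^+ 2.
Proof.
move=> u0; case: (lerP u 1) => u1.
  have : u `^ s <= 1 `^ s by apply: ge0_ler_powR; rewrite ?nnegrE ?(ltW s0).
  by rewrite powR1; have := sqr_ge0 u; lra.
have : u `^ s <= u by apply: ler1_powR => //; exact: ltW.
nra.
Qed.

(** With u = |xi| / sqrt a this is u^s <= 8 exp(u^2 / 8): the prefactor carries
the scaling, and the exponential is absorbed by half of the Gaussian in
frac_integrand_le. *)
Lemma enorm_powR_le a xi : 0 < a ->
  enorm xi `^ s <= 8 * a `^ (s / 2) * expR ((8 * a)^-1 * dotp xi xi).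
Proof.
move=> a0; have sa : 0 < Num.sqrt a by rewrite sqrtr_gt0.
have -> : enorm xi = Num.sqrt a * (enorm xi / Num.sqrt a).
  by rewrite mulrC divfK// gt_eqF.
have e0 : 0 <= enorm xi / Num.sqrt a by rewrite divr_ge0 ?enorm_ge0// ltW.
rewrite powRM//.
have -> : Num.sqrt a `^ s = a `^ (s / 2).
  by rewrite -powR12_sqrt ?(ltW a0)// -powRrM mulrC.
rewrite [8 * _]mulrC -mulrA ler_wpM2l ?powR_ge0//.
apply: (le_trans (powR_le_1Dsqr e0)).
rewrite expr_div_n enorm2 sqr_sqrtr ?(ltW a0)//.
have := expR_ge1Dx ((8 * a)^-1 * dotp xi xi).
have -> : (8 * a)^-1 * dotp xi xi = 8^-1 * (dotp xi xi / a).
  by field; rewrite gt_eqF.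
lra.
Qed.

Lemma measurable_enorm_powR :
  measurable_fun setT (fun xi : 'rV[R]_n => enorm xi `^ s).
Proof.
exact: (measurableT_comp (measurable_powR s) (@measurable_enorm R n)).
Qed.

Let integrand a x xi := enorm xi `^ s * gaussn (4 * a)^-1 xi * cos (dotp xi x).

Lemma frac_integrand_le a x xi : 0 < a ->
  `|integrand a x xi| <= 8 * a `^ (s / 2) * gaussn (8 * a)^-1 xi.
Proof.
move=> a0; rewrite /integrand normrM.
apply: (@le_trans _ _ `|enorm xi `^ s * gaussn (4 * a)^-1 xi|).
  by rewrite ler_piMr// normr_cos_le1.
rewrite ger0_norm ?mulr_ge0 ?powR_ge0 ?expR_ge0//.
have -> : (4 * a)^-1 = (8 * a)^-1 + (8 * a)^-1 by field; rewrite gt_eqF.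
rewrite gaussnD mulrA ler_wpM2r ?expR_ge0//.
apply: (le_trans (ler_wpM2r (expR_ge0 _) (enorm_powR_le xi a0))).
by rewrite -[leLHS]mulrA -expRD subrr expR0 mulr1.
Qed.

Lemma integrable_frac a x : 0 < a ->
  (leb n).-integrable setT (EFin \o integrand a x).
Proof.
move=> a0; apply: (integrable_le_gaussn (a := (8 * a)^-1)
  (K := 8 * a `^ (s / 2))).
- by rewrite invr_gt0 mulr_gt0.
- apply: measurable_funM; last exact: measurable_cos_dotp.
  apply: measurable_funM; first exact: measurable_enorm_powR.
  exact: measurable_gaussn.
- by move=> xi; exact: frac_integrand_le.
Qed.

(** The value at x of D^s applied to exp(-a |y|^2). *)
Definition frac_gauss a x : R :=
  ((2 * pi) ^+ n)^-1 *
    (Num.sqrt (pi / a) ^+ n * \int[leb n]_xi integrand a x xi).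

Lemma Re_fractional_laplacian_gsum (r : seq nat) (c al : nat -> R) x :
  (forall k, 0 < al k) ->
  complex.Re (fractional_laplacian s (fun y => (gsum r c al y)%:C) x) =
  \sum_(k <- r) c k * frac_gauss (al k) x.
Proof.
move=> al0; rewrite /fractional_laplacian fourier_multiplier_gsum//=.
pose F k xi := c k * Num.sqrt (pi / al k) ^+ n * integrand (al k) x xi.
have iF k : (leb n).-integrable setT (EFin \o F k).
  by apply: integrableZR => //; exact: integrable_frac.
rewrite (_ : Rintegral _ _ _ = \int[leb n]_xi \sum_(k <- r) F k xi); last first.
  apply: eq_Rintegral => xi _.
  rewrite /gsum_hat mulr_sumr mulr_suml; apply: eq_bigr => k _.
  by rewrite /F /integrand; ring.
have [_ ->] := integrable_sumR (mu := leb n) measurableT r iF.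
rewrite mulr_sumr; apply: eq_bigr => k _.
rewrite /F RintegralZl//; last exact: integrable_frac.
by rewrite /frac_gauss; ring.
Qed.

Definition frac_cst : R :=
  ((2 * pi) ^+ n)^-1 * (8 * Num.sqrt (8 * pi ^+ 2) ^+ n).

Lemma frac_cst_ge0 : 0 <= frac_cst.
Proof.
rewrite /frac_cst !mulr_ge0 ?invr_ge0 ?exprn_ge0 ?sqrtr_ge0//.
by rewrite mulr_ge0 ?pi_ge0.
Qed.

(** A wide Gaussian is nearly constant and D^s kills constants; this is the
scaling of D^s, with a constant uniform in x. *)
Lemma frac_gauss_small a x : 0 < a ->
  `|frac_gauss a x| <= frac_cst * a `^ (s / 2).
Proof.
move=> a0; have a8 : 0 < (8 * a)^-1 by rewrite invr_gt0 mulr_gt0.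
have p0 : 0 <= ((2 * pi) ^+ n)^-1 :> R.
  by rewrite invr_ge0 exprn_ge0// mulr_ge0 ?pi_ge0.
rewrite /frac_gauss normrM (ger0_norm p0) /frac_cst -!mulrA ler_wpM2l//.
have q0 : 0 <= Num.sqrt (pi / a) ^+ n by rewrite exprn_ge0// sqrtr_ge0.
rewrite normrM (ger0_norm q0).
have ig := integrable_gaussn n a8.
have H : `|\int[leb n]_xi integrand a x xi| <=
    8 * a `^ (s / 2) * Num.sqrt (pi / (8 * a)^-1) ^+ n.
  rewrite -Rintegral_gaussn// -RintegralZl//.
  have ii := integrable_frac x a0.
  apply: (le_trans (le_normr_Rintegral measurableT ii)).
  apply: le_Rintegral => //; first exact: integrable_normr.
    exact: integrableZR.
  by move=> xi _; exact: frac_integrand_le.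
apply: (le_trans (ler_wpM2l q0 H)).
have -> : Num.sqrt (8 * pi ^+ 2) ^+ n =
    Num.sqrt (pi / a) ^+ n * Num.sqrt (pi / (8 * a)^-1) ^+ n :> R.
  rewrite -exprMn -sqrtrM; last by rewrite divr_ge0 ?pi_ge0// ltW.
  by congr (Num.sqrt _ ^+ _); field; rewrite gt_eqF.
by rewrite le_eqVlt; apply/orP; left; apply/eqP; ring.
Qed.

Lemma cos_ge_1B (t : R) : 1 - `|t| <= cos t.
Proof.
wlog t0 : t / 0 <= t.
  move=> H; have [/H//|] := orP (le_total 0 t).
  by rewrite -oppr_ge0 => /H; rewrite normrN cosN.
have [c _] := @MVT_segment R (@cos R) (fun z : R => - sin z) 0 t t0
  (fun z _ => is_derive_cos z) (continuous_subspaceT (@continuous_cos R)).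
rewrite cos0 subr0 (ger0_norm t0) => E.
have := normr_sin_le1 c; rewrite ler_norml => /andP[h1 h2]; nra.
Qed.

Let I1 : R := \int[leb n]_xi (enorm xi `^ s * gaussn 4^-1 xi).
Let I2 : R := n%:R * 32 ^+ 2 * \int[leb n]_xi gaussn 16^-1 xi.

Let integrable_I1 : (leb n).-integrable setT
  (EFin \o (fun xi : 'rV[R]_n => enorm xi `^ s * gaussn 4^-1 xi)).
Proof.
have := integrable_frac 0 (@ltr01 R); apply: eq_integrable => // xi _ /=.
by rewrite /integrand mulr1 dotp0r cos0 mulr1.
Qed.

Let I1_gt0 : 0 < I1.
Proof.
pose Q := cube (const_mx 1 : 'rV[R]_n) 1.
have mQ : measurable Q by exact: measurable_cube.
have LQ : leb n Q = (1 ^+ n)%:E by exact: lebesgue_cube.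
have Qoo : (leb n Q < +oo)%E by rewrite LQ ltry.
pose m := expR (- n%:R) : R.
apply: (@lt_le_trans _ _ (\int[leb n]_(xi in Q) m)).
  rewrite Rintegral_cst// (_ : fine _ = 1) ?mulr1 ?expR_gt0//.
  by have := congr1 fine LQ; rewrite expr1n.
apply: (@le_trans _ _
    (\int[leb n]_(xi in Q) (enorm xi `^ s * gaussn 4^-1 xi))).
  apply: le_Rintegral => //.
  - exact: integrable_cstR.
  - exact: (integrableS measurableT _ _ integrable_I1).
  move=> xi Qxi.
  have xi1 i : 1 <= xi ord0 i <= 2.
    by have := Qxi i; rewrite mxE; lra.
  have r1 : 1 <= dotp xi xi.
    rewrite /dotp (bigD1 (Ordinal n0))//= -[leLHS]addr0 lerD//.
      by have := xi1 (Ordinal n0); nra.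
    by apply: sumr_ge0 => i _; rewrite -expr2 sqr_ge0.
  have r2 : dotp xi xi <= 4 * n%:R.
    rewrite -[n in leRHS]card_ord mulr_natr -sumr_const.
    by apply: ler_sum => i _; have := xi1 i; nra.
  have e1 : 1 <= enorm xi `^ s.
    rewrite -[leLHS](powRr0 (enorm xi)) ler_powR ?(ltW s0)//.
    by rewrite -[leLHS]sqrtr1 ler_wsqrtr.
  rewrite -[leLHS]mul1r ler_pM ?expR_ge0// ler_expR; lra.
apply: le_Rintegral_subset => // xi.
by rewrite mulr_ge0 ?powR_ge0 ?expR_ge0.
Qed.

Let I2_ge0 : 0 <= I2.
Proof.
rewrite /I2 mulr_ge0 ?mulr_ge0 ?exprn_ge0 ?ler0n//.
by apply: Rintegral_ge0 => xi _; exact: expR_ge0.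
Qed.

Let integrand_ge a x xi (rho : R) : 1 <= a -> a <= 2 -> 0 <= rho ->
  (forall i, `|x ord0 i| <= rho) ->
  enorm xi `^ s * gaussn 4^-1 xi - rho * (n%:R * 32 ^+ 2 * gaussn 16^-1 xi) <=
  integrand a x xi.
Proof.
move=> a1 a2 r0 xr.
have d0 := dotp_ge0 xi.
have w0 : 0 <= enorm xi `^ s by exact: powR_ge0.
have dx : `|dotp xi x| <= rho * (n%:R * (1 + dotp xi xi)).
  apply: (le_trans (ler_norm_sum _ _ _)).
  have -> : rho * (n%:R * (1 + dotp xi xi)) =
      \sum_(i < n) rho * (1 + dotp xi xi).
    by rewrite sumr_const card_ord -[RHS]mulr_natl mulrCA.
  apply: ler_sum => i _; rewrite normrM mulrC ler_pM//.
  have h1 : `|xi ord0 i| <= 1 + xi ord0 i ^+ 2.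
    by have := normr_le_sqr2 (xi ord0 i); have := sqr_ge0 (xi ord0 i); lra.
  apply: (le_trans h1); rewrite lerD2l /dotp (bigD1 i)//= expr2 lerDl.
  by rewrite sumr_ge0// => j _; rewrite -expr2 sqr_ge0.
have g1 : gaussn 4^-1 xi <= gaussn (4 * a)^-1 xi.
  by rewrite ler_expR lerN2 ler_wpM2r// lef_pV2 ?posrE; lra.
have g2 : gaussn (4 * a)^-1 xi <= gaussn 8^-1 xi.
  by rewrite ler_expR lerN2 ler_wpM2r// lef_pV2 ?posrE; lra.
have w1 : enorm xi `^ s <= 1 + dotp xi xi.
  by rewrite -enorm2 powR_le_1Dsqr// enorm_ge0.
have q1 : (1 + dotp xi xi) * (1 + dotp xi xi) * gaussn 8^-1 xi <=
    32 ^+ 2 * gaussn 16^-1 xi.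
  have e1 : 1 + dotp xi xi <= 32 * expR (32^-1 * dotp xi xi).
    by have := expR_ge1Dx (32^-1 * dotp xi xi); lra.
  have e2 : (1 + dotp xi xi) * (1 + dotp xi xi) <=
      (32 * expR (32^-1 * dotp xi xi)) * (32 * expR (32^-1 * dotp xi xi)).
    by rewrite ler_pM//; lra.
  apply: (le_trans (ler_wpM2r (expR_ge0 _) e2)).
  rewrite [leLHS](_ : _ = 32 ^+ 2 *
      expR (32^-1 * dotp xi xi + 32^-1 * dotp xi xi + - (8^-1 * dotp xi xi))).
    by rewrite ler_wpM2l ?exprn_ge0 ?ler0n// ler_expR; lra.
  by rewrite /gaussn 2!expRD; ring.
have ga0 : 0 <= gaussn (4 * a)^-1 xi by exact: expR_ge0.
have g80 : 0 <= gaussn 8^-1 xi by exact: expR_ge0.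
have c1 := cos_ge_1B (dotp xi x).
have wg0 := mulr_ge0 w0 ga0.
have b1 : enorm xi `^ s * gaussn (4 * a)^-1 xi * (1 - `|dotp xi x|) <=
    integrand a x xi.
  by rewrite /integrand ler_wpM2l.
have b2 : enorm xi `^ s * gaussn 4^-1 xi <=
    enorm xi `^ s * gaussn (4 * a)^-1 xi.
  by rewrite ler_wpM2l.
have b3 : enorm xi `^ s * gaussn (4 * a)^-1 xi <=
    (1 + dotp xi xi) * gaussn 8^-1 xi.
  by rewrite ler_pM.
have b4 : enorm xi `^ s * gaussn (4 * a)^-1 xi * `|dotp xi x| <=
    rho * (n%:R * 32 ^+ 2 * gaussn 16^-1 xi).
  apply: (@le_trans _ _ ((1 + dotp xi xi) * gaussn 8^-1 xi *
      (rho * (n%:R * (1 + dotp xi xi))))).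
    by rewrite ler_pM.
  rewrite [leLHS](_ : _ =
    rho * (n%:R * ((1 + dotp xi xi) * (1 + dotp xi xi) * gaussn 8^-1 xi))).
    by rewrite ler_wpM2l// -[leRHS]mulrA ler_wpM2l.
  ring.
lra.
Qed.

(** At the origin the integrand is |xi|^s times a Gaussian, which is positive.
The factor cos(xi.x) changes the integral by O(|x|), uniformly in 1 <= a <= 2, so
the bound persists on a small cube. *)
Lemma frac_gauss_lower : exists c0 rho : R, [/\ 0 < c0, 0 < rho &
  forall a x, 1 <= a -> a <= 2 -> (forall i, 0 <= x ord0 i <= rho) ->
  c0 <= frac_gauss a x].
Proof.
pose rho := I1 / (2 * (I2 + 1)).
have I21 : 0 < I2 + 1 by have := I2_ge0; lra.
have rho0 : 0 < rho by rewrite divr_gt0// mulr_gt0.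
have k0 : 0 < ((2 * pi) ^+ n)^-1 :> R.
  by rewrite invr_gt0 exprn_gt0// mulr_gt0 ?pi_gt0.
have q0 : 0 < Num.sqrt (pi / 2) ^+ n :> R.
  by rewrite exprn_gt0// sqrtr_gt0 divr_gt0 ?pi_gt0.
exists (((2 * pi) ^+ n)^-1 * (Num.sqrt (pi / 2) ^+ n * (I1 / 2))), rho.
split=> //.
  by rewrite !mulr_gt0// invr_gt0.
move=> a x a1 a2 xr; have a0 : 0 < a by lra.
rewrite /frac_gauss ler_pM2l//.
have i16 : (leb n).-integrable setT
    (EFin \o (fun xi : 'rV[R]_n => n%:R * 32 ^+ 2 * gaussn 16^-1 xi)).
  by apply: integrableZR => //; apply: integrable_gaussn; rewrite invr_gt0.
have J : I1 / 2 <= \int[leb n]_xi integrand a x xi.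
  apply: (@le_trans _ _ (\int[leb n]_xi (enorm xi `^ s * gaussn 4^-1 xi -
      rho * (n%:R * 32 ^+ 2 * gaussn 16^-1 xi)))).
    rewrite RintegralB//; last exact: integrableZR.
    rewrite RintegralZl// RintegralZl//; last first.
      by apply: integrable_gaussn; rewrite invr_gt0.
    rewrite -/I1 -/I2.
    have : rho * (I2 + 1) = I1 / 2 by rewrite /rho; field; rewrite gt_eqF.
    by rewrite mulrDr mulr1; lra.
  apply: le_Rintegral => //.
  - by apply: integrableBR => //; exact: integrableZR.
  - exact: integrable_frac.
  move=> xi _; apply: integrand_ge => //; first exact: ltW.
  by move=> i; have /andP[h1 h2] := xr i; rewrite ger0_norm.
have J0 : 0 <= I1 / 2 by rewrite divr_ge0// ltW.
rewrite ler_pM ?(ltW q0)//.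
rewrite lerXn2r ?nnegrE ?sqrtr_ge0// ler_wsqrtr// ler_pM2l ?pi_gt0//.
by rewrite lef_pV2 ?posrE.
Qed.

End frac.

(** * The commutator and the conclusion *)

Section lower.
Context {R : realType}.
Local Notation leb := (lebesgue_rV R).
Local Open Scope complex_scope.

Lemma Lp_norm_ge n (p A v : R) (Q : set 'rV[R]_n) (F : 'rV[R]_n -> R[i]) :
  0 < p -> measurable Q -> leb n Q = v%:E -> 0 <= A ->
  (forall x, Q x -> A <= Normc.normc (F x)) ->
  ((A * v `^ p^-1)%:E <= Lp_norm p F)%E.
Proof.
move=> p0 mQ LQ A0 AF; rewrite /Lp_norm unlock.
have v0 : 0 <= v by rewrite -lee_fin -LQ measure_ge0.
have n0 (z : R[i]) : 0 <= Normc.normc z by case: z => a b; exact: sqrtr_ge0.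
have H : ((A `^ p * v)%:E <= \int[leb n]_x (`|(Normc.normc (F x))%:E| `^ p))%E.
  apply: (@le_trans _ _ (\int[leb n]_x ((A `^ p)%:E * (\1_Q x)%:E))%E).
    rewrite ge0_integralZl_EFin ?powR_ge0//.
      by rewrite integral_indic// setIT EFinM -LQ.
    exact/measurable_EFinP/measurable_indic.
  apply: ge0_le_integralT => x.
    by rewrite -EFinM lee_fin mulr_ge0// powR_ge0.
  rewrite (_ : (`| _ | `^ p)%E = (`|Normc.normc (F x)| `^ p)%:E)//.
  rewrite -EFinM lee_fin ger0_norm//.
  rewrite indicE; case: (boolP (x \in Q)) => [|_]; last first.
    by rewrite mulr0 powR_ge0.
  rewrite inE mulr1 => Qx.
  by apply: ge0_ler_powR; rewrite ?nnegrE ?(ltW p0)//; exact: AF.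
apply: (@le_trans _ _ ((A `^ p * v)%:E `^ p^-1)%E).
  rewrite poweR_EFin lee_fin powRM ?powR_ge0// -powRrM mulfV ?gt_eqF//.
  by rewrite powRr1.
apply: gt0_ler_poweR => //.
- by rewrite invr_ge0 ltW.
- by rewrite in_itv/= leey andbT lee_fin mulr_ge0// powR_ge0.
- by rewrite in_itv/= leey andbT integral_ge0// => x _; exact: poweR_ge0.
Qed.

Lemma gsumM n (r : seq nat) (e c : R) (al : nat -> R) (y : 'rV[R]_n) :
  (gsum [:: 0%N] (fun=> e) (fun=> 1) y)%:C * (gsum r (fun=> c) al y)%:C =
  (gsum r (fun=> e * c) (fun k => 1 + al k) y)%:C.
Proof.
rewrite -rmorphM; congr (_%:C); rewrite /gsum big_cons big_nil addr0 mulr_sumr.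
by apply: eq_bigr => k _; rewrite gaussnD mulrACA.
Qed.

Lemma Re_subM (r : R) (z w : R[i]) :
  complex.Re (z - r%:C * w) = complex.Re z - r * complex.Re w.
Proof. by case: z => a b; case: w => a' b' /=; rewrite mul0r subr0. Qed.

(** Each of the N Gaussians in g contributes at least e c c0 to the commutator:
its product with f is a Gaussian with exponent between 1 and 2, to which
frac_gauss_lower applies, while f times its own fractional Laplacian is at most
half as large by frac_gauss_small once t is small. *)
Lemma commutator_lower n (s : R) : (0 < n)%N -> 0 < s -> s <= 1 ->
  exists c0 rho t : R, [/\ 0 < c0, 0 < rho, 0 < t &
  forall (N : nat) (e c : R) (x : 'rV[R]_n), 0 <= e -> 0 <= c ->
    (forall i, 0 <= x ord0 i <= rho) ->
    N%:R * (e * c * c0) <= Normc.normc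
      (fractional_laplacian s
         (fun y => (gsum [:: 0%N] (fun=> e) (fun=> 1) y)%:C *
           (gsum (index_iota 0 N) (fun=> c)
              (fun k => (t / 2 ^+ k) ^+ 2) y)%:C) x -
       (gsum [:: 0%N] (fun=> e) (fun=> 1) x)%:C *
       fractional_laplacian s
         (fun y => (gsum (index_iota 0 N) (fun=> c)
            (fun k => (t / 2 ^+ k) ^+ 2) y)%:C) x)].
Proof.
move=> n0 s0 s1.
have [c0 [rho [c00 rho0 H]]] := frac_gauss_lower n0 s0 s1.
have C0 := @frac_cst_ge0 R n.
pose u := c0 / (2 * (@frac_cst R n + 1)).
have u0 : 0 < u by rewrite divr_gt0// mulr_gt0//; lra.
pose t := Num.min 1 (u `^ s^-1).
have t0 : 0 < t by rewrite lt_min ltr01 powR_gt0.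
have t1 : t <= 1 by rewrite ge_min lexx.
have ts : t `^ s <= u.
  apply: (@le_trans _ _ ((u `^ s^-1) `^ s)).
    apply: ge0_ler_powR; rewrite ?nnegrE ?(ltW s0) ?(ltW t0) ?powR_ge0//.
    by rewrite ge_min lexx orbT.
  by rewrite -powRrM mulVf ?gt_eqF// powRr1// ltW.
have Cu : @frac_cst R n * u <= c0 / 2.
  have : u * (2 * (@frac_cst R n + 1)) = c0 by rewrite /u divfK// gt_eqF//; lra.
  by lra.
exists (c0 / 2), rho, t; split=> //; first by rewrite divr_gt0.
move=> N e c x e0 cc xr.
pose al k : R := (t / 2 ^+ k) ^+ 2.
have tk0 k : 0 < t / 2 ^+ k by rewrite divr_gt0// exprn_gt0.
have tk1 k : t / 2 ^+ k <= t.
  by rewrite ler_pdivrMr ?exprn_gt0// ler_peMr ?(ltW t0)// exprn_ege1// ler1n.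
have al0 k : 0 < al k by rewrite exprn_gt0.
have al1 k : al k <= 1.
  by rewrite exprn_ile1 ?(ltW (tk0 k))// (le_trans (tk1 k)).
have als k : al k `^ (s / 2) <= t `^ s.
  have -> : al k `^ (s / 2) = (t / 2 ^+ k) `^ s.
    rewrite /al -powR_mulrn ?(ltW (tk0 k))// -powRrM; congr (_ `^ _); lra.
  by apply: ge0_ler_powR; rewrite ?nnegrE ?(ltW s0) ?(ltW t0) ?(ltW (tk0 k)).
apply: le_trans (normr_Re_le _); apply: le_trans (ler_norm _).
under [X in fractional_laplacian _ X _]funext => y do rewrite gsumM.
have al2 k : 0 < 1 + al k by rewrite ltr_pwDl// ltW.
have E1 := Re_fractional_laplacian_gsum s0 s1 (index_iota 0 N)
  (fun=> e * c) x al2.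
have E2 := Re_fractional_laplacian_gsum s0 s1 (index_iota 0 N)
  (fun=> c) x al0.
rewrite -/al in E1 E2 *.
move: E1 E2; set z1 := fractional_laplacian _ _ _.
set z2 := fractional_laplacian _ _ _.
clearbody z1 z2 => E1 E2; rewrite Re_subM E1 E2 {E1 E2}.
have g1 : gaussn 1 x <= 1 by exact: gaussn_le1.
have g0 : 0 <= gaussn 1 x by exact: expR_ge0.
have -> : gsum [:: 0%N] (fun=> e) (fun=> 1) x = e * gaussn 1 x.
  by rewrite /gsum big_cons big_nil addr0.
clearbody al; rewrite mulr_sumr -sumrB.
have -> : N%:R * (e * c * (c0 / 2)) = \sum_(0 <= k < N) e * c * (c0 / 2).
  by rewrite sumr_const_nat subn0 mulr_natl.
apply: ler_sum => k _.
have h1 : c0 <= frac_gauss s (1 + al k) x.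
  by apply: H => //; have := al0 k; have := al1 k; lra.
have h2 : `|frac_gauss s (al k) x| <= c0 / 2.
  apply: (le_trans (frac_gauss_small s0 s1 x (al0 k))); apply: le_trans Cu.
  by rewrite ler_wpM2l// (le_trans (als k)).
have h3 : gaussn 1 x * frac_gauss s (al k) x <= c0 / 2.
  apply: (le_trans (ler_norm _)); rewrite normrM (ger0_norm g0).
  by apply: le_trans h2; rewrite ler_piMl.
have ec : 0 <= e * c by rewrite mulr_ge0.
move: (frac_gauss s (1 + al k) x) (frac_gauss s (al k) x) (gaussn 1 x) h1 h3.
move=> u1 u2 v h1 h3; clear -ec h1 h3.
have -> : e * c * u1 - e * v * (c * u2) = e * c * (u1 - v * u2) by ring.
by rewrite ler_wpM2l//; lra.
Qed.

End lower.

Theorem corollary7p4 (R : realType) (d : nat) (p s : R) :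
  (1 <= d)%N -> 1 < p -> 0 < s -> s <= 1 ->
  forall M : R, 0 < M ->
  exists f g : 'rV[R]_d -> R[i],
    [/\ schwartz f,
        schwartz g,
        (Lp_norm p (bessel_potential s f) + BMO_norm g <= 1%:E)%E &
        (M%:E < Lp_norm p (fun x => fractional_laplacian s (fun y => f y * g y) x
                                    - f x * fractional_laplacian s g x)%R)%E].
Proof.
move=> d1 p1 s0 s1 M M0.
have p0 : 0 < p by exact: lt_trans p1.
have [B B0 HB] := Lp_norm_bessel d1 (ltW p1) s0 s1.
have [c0 [rho [t [c00 rho0 t0 HL]]]] := commutator_lower d1 s0 s1.
case: d d1 B B0 HB HL => // n d1 B B0 HB HL.
(* With these e and c each of the two norms to be added is at most 1/2,
   whatever N is; N is then taken large. *)
pose e := (2 * (B + 1))^-1.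
have e0 : 0 < e by rewrite invr_gt0 mulr_gt0//; lra.
have eB : e * B <= 2^-1.
  have : e * (2 * (B + 1)) = 1 by rewrite mulVf// gt_eqF// mulr_gt0//; lra.
  by have := ltW e0; lra.
pose G : R := gauss_osc_cst n.+1 * 4.
have G0 : 0 <= G.
  by rewrite /G /gauss_osc_cst mulr_ge0 ?addr_ge0 ?mulr_ge0 ?sqrtr_ge0.
pose c := (2 * (G + 1))^-1.
have cp : 0 < c by rewrite invr_gt0 mulr_gt0//; lra.
have cG : c * G <= 2^-1.
  have : c * (2 * (G + 1)) = 1 by rewrite mulVf// gt_eqF// mulr_gt0//; lra.
  by have := ltW cp; lra.
pose v : R := (rho ^+ n.+1) `^ p^-1.
have v0 : 0 < v by rewrite powR_gt0// exprn_gt0.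
pose w := e * c * c0 * v.
have w0 : 0 < w by rewrite !mulr_gt0.
pose N := Num.bound (M / w).
have NM : M < N%:R * (e * c * c0) * v.
  rewrite -mulrA -/w -ltr_pdivrMr//.
  have := archi_boundP (ltW (divr_gt0 M0 w0)); rewrite -/N; exact.
exists (fun x => (gsum [:: 0%N] (fun=> e) (fun=> 1) x)%:C)%C.
exists (fun x => (gsum (index_iota 0 N) (fun=> c)
  (fun k => (t / 2 ^+ k) ^+ 2) x)%:C)%C.
split.
- by apply: schwartz_gsum => k; exact: ltr01.
- by apply: schwartz_gsum => k; rewrite exprn_gt0// divr_gt0// exprn_gt0.
- have H1 := HB e (ltW e0).
  have H2 := BMO_norm_gsum n N (ltW cp) t0.
  apply: (le_trans (leeD H1 H2)); rewrite -EFinD lee_fin -/G; lra.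
- apply: lt_le_trans (Lp_norm_ge (A := N%:R * (e * c * c0)) p0
    (measurable_cube (0 : 'rV[R]_n.+1) rho) (lebesgue_cube _ rho0) _ _).
  + by rewrite lte_fin.
  + by rewrite !mulr_ge0// ltW.
  + move=> x Qx; apply: HL; [exact: ltW|exact: ltW|move=> i].
    by have := Qx i; rewrite mxE add0r.
Qed.
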